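(* Let $f$ be a quadratic rational map and $k\in\mathbb{N}$. Then $\mathrm{Deck}(f^k)$ is isomorphic to one of: the cyclic group $\mathbb{Z}_{2^n}$ for some $n\ge1$, the Klein four-group $V_4$, or the dihedral group $D_8$ of order $8$ (symmetries of a square). Furthermore, if $f$ is not a power map then $|\mathrm{Deck}(f^k)|\le 8$.
   Context: For a rational map $F$, $\mathrm{Deck}(F)=\{\tau \text{ Möbius} : F\circ\tau=F\}$. A power map is a rational map Möbius-conjugate to $z\mapsto z^d$ or $z\mapsto z^{-d}$. $f^k$ is the $k$-th iterate. *)

(* Defs.v *)
From HB Require Import structures.
From mathcomp Require Import all_boot all_order all_algebra all_fingroup all_solvable.
From mathcomp Require Import complex.
From mathcomp Require Import reals.
Set Implicit Arguments. Unset Strict Implicit. Unset Printing Implicit Defensive.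
Import Order.TTheory GRing.Theory Num.Theory.
Local Open Scope ring_scope.

Section RiemannSphere.
Variable R : realType.
Local Notation C := (R[i]).

(* The Riemann sphere: [Some z] is the finite point z, [None] is infinity. *)
Definition sphere := option C.

(* The map of the Riemann sphere induced by the rational function p/q
   (p, q coprime, not both zero).  At infinity it takes the limit value. *)
Definition rat_eval (p q : {poly C}) : sphere -> sphere :=
  fun z => match z with
  | Some x => if q.[x] != 0 then Some (p.[x] / q.[x]) else None
  | None => if (size q < size p)%N then None
            else if (size p < size q)%N then Some 0
            else Some (lead_coef p / lead_coef q)
  end.

Definition rational_map_of_degree (d : nat) (F : sphere -> sphere) : Prop :=
  exists p q : {poly C}, [/\ coprimep p q, (maxn (size p) (size q)).-1 = d,
                             q != 0 & F = rat_eval p q].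

Definition moebius (t : sphere -> sphere) : Prop :=
  exists a b c d : C, a * d - b * c != 0 /\
    t = rat_eval (a *: 'X + b%:P) (c *: 'X + d%:P).

Definition Deck (F : sphere -> sphere) : (sphere -> sphere) -> Prop :=
  fun t => moebius t /\ F \o t = F.

Definition power_map (F : sphere -> sphere) : Prop :=
  exists (n : nat) (mu nu : sphere -> sphere),
    [/\ (0 < n)%N, moebius mu, moebius nu, mu \o nu = id /\ nu \o mu = id &
     (F = mu \o rat_eval ('X^n) 1 \o nu \/ F = mu \o rat_eval 1 ('X^n) \o nu)].

End RiemannSphere.

Definition group_iso_to (gT : finGroupType) (X : Type) (S : (X -> X) -> Prop) :=
  exists phi : gT -> (X -> X),
    [/\ injective phi,
        (forall g h : gT, phi (g * h)%g = phi g \o phi h) &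
        (forall t, S t <-> exists g, phi g = t)].

Definition Klein4 : finGroupType := ('Z_2 * 'Z_2)%type.
Definition Dihedral8 : finGroupType := 'D_8.

(* Main.v *)
(* Write f = M o (z |-> z^2), M a Moebius map, so that the critical points are 0 and oo,
   and let G_k = Deck(f^k); these groups increase with k.  The local degree of f^k at z
   is 2^e_k(z), where e_k(z) counts the visits of z, f(z), ..., f^(k-1)(z) to {0, oo}.
   Elements of G_k preserve both f^k and e_k, and g in G_k acts near a fixed point z as
   a rotation of order dividing 2^e_k(z).
   - If M preserves {0, oo}, f is a power map and G_k = {z |-> a z : a^(2^k) = 1}.
   - Otherwise every g in G_k satisfies g^4 = 1.  If no critical point is periodic, no
     orbit visits a critical point twice, so e_k <= 2.  If one is periodic, the pair
     (f^k, e_k) separates a critical point from all noncritical points for arbitrarily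
     large k, so G_k preserves {0, oo}; a rotation in G_k then descends to an element of
     G_(k-1) fixing the critical values and preserving {0, oo}, hence of order <= 2.
   - A group of Moebius maps with g^4 = 1 for all g is, in suitable coordinates,
     generated by a rotation of order at most 4 and possibly some z |-> b / z. *)

Require Import Defs.
From HB Require Import structures.
From mathcomp Require Import all_boot all_order all_algebra all_fingroup all_solvable.
From mathcomp Require Import boolp ring.
From mathcomp Require Import complex reals.
Set Implicit Arguments. Unset Strict Implicit. Unset Printing Implicit Defensive.
Import Order.TTheory GRing.Theory Num.Theory.
Local Open Scope ring_scope.

(** * Moebius maps in homogeneous coordinates *)

(** Local degrees are handled without derivatives: a map is lifted to the plane in homogeneous
    coordinates, so that a fibre is the list of zeros of a binary form and infinity is a point like
    any other. Unique factorization makes local degrees invariant under deck maps, and a chain rule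
    computes them for iterates. As fibres are finite, no deck map is conjugate to a translation, so
    each one is a rotation about two fixed points.

    The obstacle is a periodic critical point: [e_k] may then be unbounded and no longer bounds
    orders. Enlarging k is harmless because the groups increase, but it characterizes only one
    critical point c. That g c and g (g c) are critical settles the case where g moves c; if g fixes
    c, it also fixes the other critical point, since otherwise g and z |-> - z would generate a
    translation.

    The descended map has order at most 2 for this reason: it fixes both critical values, one of
    which lies outside {0, oo}. A rotation about 0 and oo with a third fixed point is trivial, and a
    flip is an involution.

    The bound 8 is 4 * 2: the flips in a group form at most one coset of its rotations. *)

Section Moebius.
Variable K : numClosedFieldType.
Implicit Types (x y a b c d : K) (z w : option K) (g h : option K -> option K).

(** The pair (0, 0) is also sent to infinity; the guard [nonzero2] keeps this junk value out. *)
Definition proj x y : option K := if y != 0 then Some (x / y) else None.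
Definition hx z : K := if z is Some x then x else 1.
Definition hy z : K := if z is Some _ then 1 else 0.
Definition nonzero2 x y := (x != 0) || (y != 0).

Lemma projK z : proj (hx z) (hy z) = z.
Proof. by case: z => [x|] /=; rewrite /proj ?oner_eq0 ?divr1 // eqxx. Qed.

Lemma nonzero2_h z : nonzero2 (hx z) (hy z).
Proof. by case: z => [x|]; rewrite /nonzero2 /= oner_eq0 ?orbT. Qed.

Lemma proj_eq x y x' y' : nonzero2 x y -> nonzero2 x' y' ->
  (proj x y == proj x' y') = (x * y' == x' * y).
Proof.
rewrite /proj /nonzero2; have [->|y0] := eqVneq y 0; have [->|y'0] := eqVneq y' 0.
- by rewrite !mulr0 !eqxx.
- by rewrite orbF mulr0 mulf_eq0 (negPf y'0) orbF => /negPf->.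
- by rewrite orbF mulr0 => _ x'0; rewrite [RHS]eq_sym mulf_eq0 (negPf y0) orbF (negPf x'0).
- by move=> _ _; rewrite (inj_eq (@Some_inj _)) eqr_div.
Qed.

Lemma proj_scale k x y : k != 0 -> proj (k * x) (k * y) = proj x y.
Proof.
by move=> k0; rewrite /proj mulf_eq0 (negPf k0) /= -mulf_div divff // mul1r.
Qed.

Lemma proj_hE x y : nonzero2 x y -> exists2 k, k != 0 &
  x = k * hx (proj x y) /\ y = k * hy (proj x y).
Proof.
rewrite /proj /nonzero2; have [->|y0 _] := eqVneq y 0.
  by rewrite orbF => x0; exists x => //=; rewrite mulr1 mulr0.
by exists y => //=; rewrite mulr1 mulrC divfK.
Qed.

Definition mob a b c d : option K -> option K :=
  fun z => proj (a * hx z + b * hy z) (c * hx z + d * hy z).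

Lemma nonzero2_lin a b c d x y : a * d - b * c != 0 -> nonzero2 x y ->
  nonzero2 (a * x + b * y) (c * x + d * y).
Proof.
move=> D; apply: contraTT; rewrite !negb_or !negbK => /andP[/eqP e1 /eqP e2].
have ex : (a * d - b * c) * x = 0.
  by transitivity (d * (a * x + b * y) - b * (c * x + d * y)); [ring|rewrite e1 e2 !mulr0 subr0].
have ey : (a * d - b * c) * y = 0.
  by transitivity (a * (c * x + d * y) - c * (a * x + b * y)); [ring|rewrite e1 e2 !mulr0 subr0].
move/eqP: ex; move/eqP: ey; rewrite !mulf_eq0 (negPf D) /=.
by move=> /eqP-> /eqP->; rewrite eqxx.
Qed.

Lemma mob_proj a b c d x y : a * d - b * c != 0 -> nonzero2 x y ->
  mob a b c d (proj x y) = proj (a * x + b * y) (c * x + d * y).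
Proof.
move=> D nz; have [k k0 [ex ey]] := proj_hE nz.
rewrite /mob; move: (hx _) (hy _) ex ey => u v -> ->.
by rewrite -[LHS](proj_scale _ _ k0); congr (proj _ _); ring.
Qed.

Lemma mob_comp a b c d a' b' c' d' : a * d - b * c != 0 -> a' * d' - b' * c' != 0 ->
  mob a b c d \o mob a' b' c' d' =
  mob (a * a' + b * c') (a * b' + b * d') (c * a' + d * c') (c * b' + d * d').
Proof.
move=> D D'; apply: funext => z /=.
rewrite [X in mob _ _ _ _ X]/mob mob_proj ?nonzero2_lin ?nonzero2_h //.
by rewrite /mob; congr (proj _ _); ring.
Qed.

Lemma mob_scale k a b c d : k != 0 -> mob (k * a) (k * b) (k * c) (k * d) = mob a b c d.
Proof.
move=> k0; apply: funext => z; rewrite /mob -[RHS](proj_scale _ _ k0).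
by congr (proj _ _); ring.
Qed.

Lemma mob1 : mob 1 0 0 1 = id.
Proof. by apply: funext => z; rewrite /mob !mul1r !mul0r addr0 add0r projK. Qed.

Lemma mob_eq_id a b c d : a * d - b * c != 0 -> mob a b c d = id -> [/\ b = 0, c = 0 & a = d].
Proof.
move=> D e; have E z : a * hx z * hy z + b * hy z ^+ 2 = c * hx z ^+ 2 + d * hx z * hy z.
  have /(congr1 (@^~ z)) := e; rewrite /mob -[RHS](projK z) => /eqP.
  rewrite proj_eq ?nonzero2_lin ?nonzero2_h // => /eqP ez.
  transitivity ((a * hx z + b * hy z) * hy z); first by ring.
  by rewrite ez; ring.
have := E None; rewrite /= !expr2 !(mulr0, mulr1, addr0, mul0r) => c0.
have := E (Some 0); rewrite /= !expr2 !(mulr0, mulr1, addr0, add0r, mul0r) => b0.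
by have := E (Some 1); rewrite /= !expr2 !mulr1 b0 -c0 addr0 add0r.
Qed.

Definition isMob g := exists a b c d, a * d - b * c != 0 /\ g = mob a b c d.

Lemma isMob_mob a b c d : a * d - b * c != 0 -> isMob (mob a b c d).
Proof. by exists a, b, c, d. Qed.

Lemma isMob_id : isMob id.
Proof. by rewrite -mob1; apply: isMob_mob; rewrite mulr1 mul0r subr0 oner_eq0. Qed.

Lemma isMob_comp g h : isMob g -> isMob h -> isMob (g \o h).
Proof.
move=> [a [b [c [d [D ->]]]]] [a' [b' [c' [d' [D' ->]]]]].
rewrite mob_comp //; apply: isMob_mob.
rewrite (_ : _ - _ = (a * d - b * c) * (a' * d' - b' * c')) ?mulf_neq0 //; ring.
Qed.

Lemma mobK a b c d : a * d - b * c != 0 -> mob d (- b) (- c) a \o mob a b c d = id.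
Proof.
move=> D; have D' : d * a - - b * - c != 0 by rewrite mulrNN mulrC.
rewrite mob_comp // -mob1 -(mob_scale 1 0 0 1 D); congr mob; ring.
Qed.

Lemma isMob_inv g : isMob g -> exists h, [/\ isMob h, g \o h = id & h \o g = id].
Proof.
move=> [a [b [c [d [D ->]]]]].
have D' : d * a - - b * - c != 0 by rewrite mulrNN mulrC.
exists (mob d (- b) (- c) a); split; [exact: isMob_mob| |exact: mobK].
by have := mobK D'; rewrite !opprK.
Qed.

Lemma isMob_inj g : isMob g -> injective g.
Proof.
move=> /isMob_inv [h [_ _ hK]] x y e.
by rewrite -[x]/(id x) -[y]/(id y) -hK /= e.
Qed.

Definition scal a := mob a 0 0 1.

Lemma scalE a x : scal a (Some x) = Some (a * x).
Proof. by rewrite /scal /mob /= !(mul0r, add0r, mulr1, addr0) /proj oner_eq0 divr1. Qed.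

Lemma scal_inf a : scal a None = None.
Proof. by rewrite /scal /mob /= !(mul0r, add0r, mulr0, addr0) /proj eqxx. Qed.

Lemma isMob_scal a : a != 0 -> isMob (scal a).
Proof. by move=> a0; apply: isMob_mob; rewrite mulr1 mul0r subr0. Qed.

Lemma scal_comp a b : scal a \o scal b = scal (a * b).
Proof. by apply: funext => -[x|] /=; rewrite ?scalE ?scal_inf // mulrA. Qed.

Lemma scal1 : scal 1 = id. Proof. exact: mob1. Qed.

Lemma iter_scal a n : iter n (scal a) = scal (a ^+ n).
Proof.
elim: n => [|n IH]; first by rewrite expr0 scal1.
by rewrite exprS -scal_comp -IH.
Qed.

Lemma scal_inj a b : scal a = scal b -> a = b.
Proof. by move=> /(congr1 (@^~ (Some 1))); rewrite !scalE !mulr1 => -[]. Qed.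

Definition flip b := mob 0 b 1 0.

Lemma isMob_flip b : b != 0 -> isMob (flip b).
Proof. by move=> b0; apply: isMob_mob; rewrite mul0r mulr1 sub0r oppr_eq0. Qed.

Lemma mob_diag a d : a * d != 0 -> mob a 0 0 d = scal (a / d).
Proof.
rewrite mulf_eq0 negb_or => /andP[a0 d0].
by rewrite -(mob_scale a 0 0 d (invr_neq0 d0)) !mulr0 mulVf // mulrC.
Qed.

Lemma mob_antidiag b c : b * c != 0 -> mob 0 b c 0 = flip (b / c).
Proof.
rewrite mulf_eq0 negb_or => /andP[b0 c0].
by rewrite -(mob_scale 0 b c 0 (invr_neq0 c0)) !mulr0 mulVf // mulrC.
Qed.

Lemma scal_flip a b : a != 0 -> b != 0 -> scal a \o flip b = flip (a * b).
Proof.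
move=> a0 b0; rewrite mob_comp; last 2 first.
- by rewrite mulr1 mul0r subr0.
- by rewrite mul0r mulr1 sub0r oppr_eq0.
by congr mob; ring.
Qed.

Lemma flip_scal a b : a != 0 -> b != 0 -> flip b \o scal a = flip (b / a).
Proof.
move=> a0 b0; rewrite mob_comp; last 2 first.
- by rewrite mul0r mulr1 sub0r oppr_eq0.
- by rewrite mulr1 mul0r subr0.
rewrite !(mul0r, mulr0, mulr1, mul1r, addr0, add0r) mob_antidiag ?mulf_neq0 //.
Qed.

Lemma flip_flip b c : b != 0 -> c != 0 -> flip b \o flip c = scal (b / c).
Proof.
move=> b0 c0; rewrite mob_comp; last 2 first.
- by rewrite mul0r mulr1 sub0r oppr_eq0.
- by rewrite mul0r mulr1 sub0r oppr_eq0.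
rewrite !(mul0r, mulr0, mulr1, mul1r, addr0, add0r) mob_diag ?mulf_neq0 //.
Qed.

Lemma flip0 b : flip b (Some 0) = None.
Proof. by rewrite /flip /mob /= !(mul0r, mulr0, addr0) /proj eqxx. Qed.

Lemma flip_inf b : flip b None = Some 0.
Proof. by rewrite /flip /mob /= !(mul0r, mulr0, addr0, mulr1) /proj oner_eq0 mul0r. Qed.

(** The infinite orbit excludes translations, both from deck groups and from groups of exponent
    4. *)
Lemma iter_translation n : iter n (mob 1 1 0 1) (Some 0) = Some n%:R.
Proof.
elim: n => //= n ->; rewrite /mob /proj /= mul0r add0r !mul1r oner_eq0 divr1.
by rewrite natr1.
Qed.

Lemma mob_inf a b c d : mob a b c d None = proj a c.
Proof. by rewrite /mob /= !mulr1 !mulr0 !addr0. Qed.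

Lemma mob_0 a b c d : mob a b c d (Some 0) = proj b d.
Proof. by rewrite /mob /= !mulr1 !mulr0 !add0r. Qed.

Lemma isMob_fix0inf g : isMob g -> g (Some 0) = Some 0 -> g None = None ->
  exists2 a, a != 0 & g = scal a.
Proof.
move=> [a [b [c [d [D ->]]]]]; rewrite mob_0 mob_inf /proj.
case: eqP => // d0 [] /eqP; rewrite mulf_eq0 invr_eq0 (introF eqP d0) orbF => /eqP b0.
case: eqP => // c0 _; subst b c; move: D; rewrite mul0r subr0 => D.
exists (a / d); last by rewrite mob_diag.
by move: D; rewrite !mulf_eq0 invr_eq0.
Qed.

Lemma isMob_swap0inf g : isMob g -> g (Some 0) = None -> g None = Some 0 ->
  exists2 b, b != 0 & g = flip b.
Proof.
move=> [a [b [c [d [D ->]]]]]; rewrite mob_0 mob_inf /proj.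
case: eqP => // d0 _; case: eqP => // c0 [] /eqP.
rewrite mulf_eq0 invr_eq0 (introF eqP c0) orbF => /eqP a0.
subst a d; move: D; rewrite mul0r sub0r oppr_eq0 => D.
exists (b / c); last by rewrite mob_antidiag.
by move: D; rewrite !mulf_eq0 invr_eq0.
Qed.

Lemma isMob_to0 z : exists2 h, isMob h & h (Some 0) = z.
Proof.
case: z => [x|].
  exists (mob 1 x 0 1); last by rewrite mob_0 /proj oner_eq0 divr1.
  by apply: isMob_mob; rewrite mulr1 mulr0 subr0 oner_eq0.
by exists (flip 1); [apply: isMob_flip; rewrite oner_eq0|rewrite flip0].
Qed.

Lemma isMob_to0inf z w : z != w -> exists h, [/\ isMob h, h (Some 0) = z & h None = w].
Proof.
move=> zw; have [h hM h0] := isMob_to0 z.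
have [h' [h'M hK h'K]] := isMob_inv hM.
case E: (h' w) => [y|]; last first.
  exists h; split => //; rewrite -E; exact: (congr1 (@^~ w) hK).
have y0 : y != 0.
  apply: contra_neqN zw => /eqP y0; rewrite -h0 -y0 -E; exact: (congr1 (@^~ w) hK).
(* The map x |-> y x / (x + 1) fixes 0 and sends infinity to [y], the preimage of [w] under [h]. *)
exists (h \o mob y 0 1 1); split => /=.
- by apply: isMob_comp hM _; apply: isMob_mob; rewrite mulr1 mul0r subr0.
- by rewrite mob_0 /proj oner_eq0 mul0r.
- rewrite mob_inf /proj oner_eq0 divr1 -E; exact: (congr1 (@^~ w) hK).
Qed.

Lemma isMob_fixpoint g : isMob g -> exists z, g z = z.
Proof.
move=> [a [b [c [d [D ->]]]]]; have [->|c0] := eqVneq c 0.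
  by exists None; rewrite mob_inf /proj eqxx.
(* The square root of the discriminant of the fixed-point equation c x^2 - (a - d) x - b = 0. *)
pose r := sqrtC ((a - d) ^+ 2 + 4 * b * c).
pose x := ((a - d) + r) / (2 * c).
exists (Some x); apply/eqP; rewrite -[X in _ == X]projK [mob _ _ _ _ _]/mob.
rewrite proj_eq ?nonzero2_lin ?nonzero2_h //=; apply/eqP.
have r2 : r ^+ 2 = (a - d) ^+ 2 + 4 * b * c by rewrite sqrtCK.
have E : (4 * c) * (c * x ^+ 2 - (a - d) * x - b) = 0.
  transitivity (r ^+ 2 - (a - d) ^+ 2 - 4 * b * c); last by rewrite r2; ring.
  by rewrite /x; field.
move/eqP: E; rewrite !mulf_eq0 (negPf c0) pnatr_eq0 /= => /eqP E.
have -> : (a * x + b * 1) * 1 = x * (c * x + d * 1) - (c * x ^+ 2 - (a - d) * x - b) by ring.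
by rewrite E subr0.
Qed.

(** This is the Jordan form: two fixed points moved to 0 and infinity leave a scaling, while a
    single fixed point moved to infinity leaves a translation. *)
Lemma isMob_normal_form g : isMob g -> exists h h', [/\ isMob h, isMob h',
  h \o h' = id, h' \o h = id & (exists2 a, a != 0 & g = h \o scal a \o h') \/
    g = h \o mob 1 1 0 1 \o h'].
Proof.
move=> gM; have [w gw] := isMob_fixpoint gM.
have [[z zw gz]|nz] := pselect (exists2 z, z != w & g z = z).
  have [h [hM h0 hi]] := isMob_to0inf zw.
  have [h' [h'M hK h'K]] := isMob_inv hM; exists h, h'; split => //; left.
  have hk (x : option K) : h (h' x) = x by exact: (congr1 (@^~ x) hK).
  have h'z : h' z = Some 0 by rewrite -h0; exact: (congr1 (@^~ _) h'K).
  have h'w : h' w = None by rewrite -hi; exact: (congr1 (@^~ _) h'K).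
  have [||| a a0 e] := @isMob_fix0inf (h' \o g \o h).
  - by apply: isMob_comp hM; apply: isMob_comp.
  - by rewrite /= h0 gz.
  - by rewrite /= hi gw.
  by exists a => //; rewrite -e; apply: funext => x /=; rewrite !hk.
have [z zw] : exists z, z != w by case: w {gw nz} => [x|]; [exists None|exists (Some 0)].
have [h [hM h0 hi]] := isMob_to0inf zw.
have [h' [h'M hK h'K]] := isMob_inv hM.
have hk (x : option K) : h (h' x) = x by exact: (congr1 (@^~ x) hK).
have h'w : h' w = None by rewrite -hi; exact: (congr1 (@^~ _) h'K).
have [] : isMob (h' \o g \o h) by apply: isMob_comp hM; apply: isMob_comp.
move=> a [b [c [d [D e]]]].
have c0 : c = 0.
  have /(congr1 (@^~ None)) /= := e; rewrite hi gw h'w mob_inf /proj.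
  by case: eqP.
subst c; move: D; rewrite mulr0 subr0 mulf_eq0 negb_or => /andP[a0 d0].
(* A finite fixed point of the conjugated map would give [g] a second fixed point; this forces a = d
   and b != 0. *)
have gfix x : (a - d) * x + b = 0 -> False.
  move=> ex; apply: nz; exists (h (Some x)).
    by rewrite -hi (inj_eq (isMob_inj hM)).
  have /(congr1 (@^~ (Some x))) /= := e.
  have -> : mob a b 0 d (Some x) = Some x.
    rewrite /mob /proj /= mul0r add0r !mulr1 d0; congr Some.
    have -> : a * x + b = d * x by apply/eqP; rewrite -subr_eq0 -ex; apply/eqP; ring.
    by rewrite mulrC mulKf.
  by move=> /(congr1 h); rewrite hk.
have [ad|] := eqVneq (a - d) 0; last first.
  by move=> ad; case: (gfix (- b / (a - d))); rewrite mulrC divfK // addNr.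
have b0 : b != 0 by apply/eqP => b0; apply: (gfix 0); rewrite mulr0 add0r.
have ea : a = d by apply/eqP; rewrite -subr_eq0 ad.
subst d.
have ba0 : b / a != 0 by rewrite mulf_neq0 ?invr_eq0.
(* Rescaling by b / a turns the translation by b / a into the translation by 1. *)
exists (h \o scal (b / a)), (scal (a / b) \o h').
have sK : scal (b / a) \o scal (a / b) = id.
  by rewrite scal_comp -scal1; congr scal; field; rewrite a0 b0.
have sK' : scal (a / b) \o scal (b / a) = id.
  by rewrite scal_comp -scal1; congr scal; field; rewrite a0 b0.
have ab0 : a / b != 0 by rewrite mulf_neq0 ?invr_eq0.
split.
- by apply: isMob_comp => //; apply: isMob_scal.
- by apply: isMob_comp => //; apply: isMob_scal.
- by rewrite compA -(compA h) sK; exact: hK.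
- by rewrite compA -(compA _ h') h'K; exact: sK'.
have D1 : (1 : K) * 1 - 1 * 0 != 0 by rewrite mulr1 mulr0 subr0 oner_eq0.
have D2 : a / b * 1 - 0 * 0 != 0 by rewrite mulr1 mulr0 subr0.
right; suff eT : mob a b 0 a = scal (b / a) \o (mob 1 1 0 1 \o scal (a / b)).
  by move: e; rewrite eT => e; apply: funext => x; rewrite -[LHS]hk -[x in LHS]hk -[LHS]/(h ((h' \o g \o h) (h' x))) e.
rewrite /scal (mob_comp D1 D2) mob_comp; last 2 first.
- by rewrite mulr1 mulr0 subr0.
- by rewrite !(mulr0, mul0r, mulr1, mul1r, subr0, addr0, add0r).
rewrite -[RHS](mob_scale _ _ _ _ a0); congr mob; last by ring.
- by field; rewrite b0.
- by field; rewrite a0.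
- by ring.
Qed.

End Moebius.

(** * Fibers and local degrees *)

Section Fibers.
Variable K : numClosedFieldType.
Implicit Types (x y : K) (z w a b : option K) (F g h : option K -> option K)
  (D : option K -> seq (option K)).

Lemma horner_ext (p q : {poly K}) : (forall t, p.[t] = q.[t]) -> p = q.
Proof.
move=> e; apply/eqP; rewrite -subr_eq0; apply: contraT => pq0.
have := max_poly_roots pq0 (rs := [seq n%:R | n <- iota 0 (size (p - q))]).
rewrite size_map size_iota ltnn; apply.
  by apply/allP => x _; rewrite /root hornerD hornerN e subrr.
by rewrite map_inj_uniq ?iota_uniq // => m n /eqP; rewrite eqr_nat => /eqP.
Qed.

Definition linf x y a : K := x * hy a - y * hx a.

(** The form [linf] at y = 1. Infinity becomes a constant, so its multiplicity is invisible here and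
    has to be recovered from the total degree. *)
Definition linp a : {poly K} := if a is Some s then 'X - s%:P else - 1%:P.

Lemma horner_linp a x : (linp a).[x] = linf x 1 a.
Proof.
by case: a => [s|]; rewrite /linf /= ?hornerXsubC ?hornerN ?hornerC !mul1r ?mulr1 // mulr0 sub0r.
Qed.

Lemma linf_eq0 x y a : nonzero2 x y -> (linf x y a == 0) = (proj x y == a).
Proof.
move=> nz; rewrite -{2}[a]projK proj_eq ?nonzero2_h // /linf subr_eq0.
by rewrite [y * _]mulrC.
Qed.

(* [D w] lists the [d] preimages of [w] under [F] with their multiplicities:
   [F] lifts to a map [(P, Q)] of the plane such that [P * hy w - Q * hx w] is the
   product of the linear forms vanishing on the preimages, up to a scalar. *)
Definition isfib (d : nat) F D := exists P Q : K -> K -> K,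
  (forall x y, nonzero2 x y ->
     nonzero2 (P x y) (Q x y) /\ F (proj x y) = proj (P x y) (Q x y)) /\
  (forall w, size (D w) = d /\ exists2 c, c != 0 &
     forall x y, linf (P x y) (Q x y) w = c * \prod_(a <- D w) linf x y a).

Lemma mem_fib d F D : isfib d F D -> forall w a, (a \in D w) = (F a == w).
Proof.
move=> [P [Q [H1 H2]]] w a; have [_ [c c0 H]] := H2 w.
have [nz e] := H1 _ _ (nonzero2_h a); rewrite projK in e.
rewrite e -linf_eq0 // H mulf_eq0 (negPf c0) /= prodf_seq_eq0 /=.
elim: (D w) => //= b s IH; rewrite inE IH linf_eq0 ?nonzero2_h // projK.
by [].
Qed.

(** Substituting the inner lift into the factorization of the outer one replaces the linear form of
    each point [b] by the product over the fibre [D' b]. *)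
Lemma isfib_comp d d' F F' D D' : isfib d F D -> isfib d' F' D' ->
  isfib (d * d') (F \o F') (fun w => flatten [seq D' b | b <- D w]).
Proof.
move=> [P [Q [H1 H2]]] [P' [Q' [H1' H2']]].
exists (fun x y => P (P' x y) (Q' x y)), (fun x y => Q (P' x y) (Q' x y)); split.
  move=> x y nz; have [nz' e'] := H1' x y nz; have [nz'' e] := H1 _ _ nz'.
  by split=> //=; rewrite e' e.
move=> w; have [<- [c c0 H]] := H2 w; split.
  rewrite size_flatten /shape -map_comp (eq_map (g := fun=> d')); last first.
    by move=> b /=; case: (H2' b).
  by elim: (D w) => //= b s ->; rewrite mulSn.
suff [c' c'0 H'] : exists2 c', c' != 0 & forall x y,
    \prod_(b <- D w) linf (P' x y) (Q' x y) b =
    c' * \prod_(a <- flatten [seq D' b | b <- D w]) linf x y a.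
  by exists (c * c'); [rewrite mulf_neq0|move=> x y; rewrite H H' mulrA].
elim: (D w) => [|b s [c' c'0 IH]] /=.
  by exists 1; [rewrite oner_eq0|move=> x y; rewrite !big_nil mulr1].
have [_ [e e0 Hb]] := H2' b; exists (e * c'); first by rewrite mulf_neq0.
by move=> x y; rewrite big_cons big_cat IH Hb /=; ring.
Qed.

Lemma isfib_mob g h : isMob g -> g \o h = id -> isfib 1 g (fun w => [:: h w]).
Proof.
move=> [a [b [c [d [D eg]]]]] gh.
exists (fun x y => a * x + b * y), (fun x y => c * x + d * y); split.
  by move=> x y nz; rewrite eg mob_proj // nonzero2_lin.
move=> w; split => //.
pose u := hx (h w); pose v := hy (h w).
have nz : nonzero2 u v by exact: nonzero2_h.
(* The factor [k] compares the image of the representative of [h w] with the representative of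
   [w]. *)
have [k k0 [e1 e2]] := proj_hE (nonzero2_lin D nz).
have ew : proj (a * u + b * v) (c * u + d * v) = w.
  by rewrite -mob_proj // -eg projK; exact: (congr1 (@^~ w) gh).
rewrite ew in e1 e2.
exists (k^-1 * (a * d - b * c)); first by rewrite mulf_neq0 ?invr_eq0.
move=> x y; rewrite big_seq1 /linf -/u -/v.
apply: (mulfI k0); rewrite !mulrA divff // mul1r mulrBr.
rewrite [k * (_ * hy w)]mulrCA [k * (_ * hx w)]mulrCA.
by rewrite -e1 -e2; ring.
Qed.

Definition sq z := if z is Some x then Some (x ^+ 2) else None.

(** The two entries coincide exactly over 0 and infinity, which gives the critical points
    multiplicity 2. *)
Definition sq_fib w : seq (option K) :=
  if w is Some x then [:: Some (sqrtC x); Some (- sqrtC x)] else [:: None; None].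

Lemma isfib_sq : isfib 2 sq sq_fib.
Proof.
exists (fun x _ => x ^+ 2), (fun _ y => y ^+ 2); split.
  move=> x y nz; split; first by move: nz; rewrite /nonzero2 !expf_eq0.
  by rewrite /proj expf_eq0 /=; case: eqP => //= _; rewrite expr_div_n.
case=> [s|]; split=> //.
  exists 1; first by rewrite oner_eq0.
  move=> x y; rewrite !big_cons big_nil /linf /=.
  by have := sqrtCK s; move: (sqrtC s) => r <-; ring.
exists (-1); first by rewrite oppr_eq0 oner_eq0.
by move=> x y; rewrite !big_cons big_nil /linf /=; ring.
Qed.

Lemma linp_prod (s : seq (option K)) :
  \prod_(a <- s) linp a =
  ((-1) ^+ count_mem None s) *: \prod_(r <- pmap id s) ('X - r%:P).
Proof.
elim: s => [|[r|] s IH] /=; rewrite ?big_nil ?expr0 ?scale1r // !big_cons IH /=.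
  by rewrite add0n scalerAr.
by rewrite exprS -scalerA scaleN1r mulNr mul1r.
Qed.

(** Unique factorization determines the finite points with their multiplicities; equality of sizes
    then determines how often infinity occurs. *)
Lemma linp_uniq c c' (s s' : seq (option K)) : c != 0 -> c' != 0 -> size s = size s' ->
  c *: \prod_(a <- s) linp a = c' *: \prod_(a <- s') linp a -> perm_eq s s'.
Proof.
move=> c0 c'0 ss; rewrite !linp_prod !scalerA.
set e := c * _; set e' := c' * _ => E.
have e0 : e != 0 by rewrite mulf_neq0 // signr_eq0.
have e'0 : e' != 0 by rewrite mulf_neq0 // signr_eq0.
have ee : e = e'.
  have := congr1 lead_coef E; rewrite !lead_coefZ.
  by rewrite !(monicP (monic_prod_XsubC _ _ _)) !mulr1.
have pm := etrans E (congr1 (fun k => k *: _) (esym ee)); have {}pm := prod_XsubC_eq (scalerI e0 pm).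
have cS (t : seq (option K)) r : count_mem (Some r) t = count_mem r (pmap id t).
  by elim: t => //= -[r'|] t /= ->.
have cN (t : seq (option K)) : (count_mem None t + size (pmap id t))%N = size t.
  by elim: t => //= -[r'|] t /= <-; rewrite ?addnS.
apply/allP => -[r|] _ /=; first by rewrite !cS (seq.permP pm).
by rewrite -(eqn_add2r (size (pmap id s))) cN (perm_size pm) cN ss.
Qed.

Lemma linf_prod_horner (s : seq (option K)) x :
  \prod_(a <- s) linf x 1 a = (\prod_(a <- s) linp a).[x].
Proof. by rewrite horner_prod; apply: eq_bigr => a _; rewrite horner_linp. Qed.

Lemma nonzero2_1 x : nonzero2 x 1.
Proof. by rewrite /nonzero2 oner_eq0 orbT. Qed.

Lemma exists_neq z : exists w, w != z.
Proof. by case: z => [r|]; [exists None|exists (Some 0)]. Qed.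

(* The two lifts are parallel, so the forms attached to [w] and [w'] satisfy a
   cross-product identity, where unique factorization applies. *)
Lemma isfib_uniq d F D D' w : isfib d F D -> isfib d F D' -> perm_eq (D w) (D' w).
Proof.
move=> fD fD'; have [w' ww'] := exists_neq w.
have [P [Q [H1 H2]]] := fD; have [P' [Q' [H1' H2']]] := fD'.
have [s [c c0 H]] := H2 w; have [s1 [c1 c10 H_1]] := H2 w'.
have [s' [c' c'0 H']] := H2' w; have [s'1 [c'1 c'10 H'_1]] := H2' w'.
have pm : perm_eq (D w ++ D' w') (D w' ++ D' w).
  apply: (@linp_uniq (c * c'1) (c1 * c')); rewrite ?mulf_neq0 //.
    by rewrite !size_cat s s1 s' s'1.
  apply: horner_ext => t; rewrite !hornerZ !big_cat /= !hornerM -!linf_prod_horner.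
  have [nz e] := H1 _ _ (nonzero2_1 t); have [nz' e'] := H1' _ _ (nonzero2_1 t).
  have /eqP : proj (P t 1) (Q t 1) = proj (P' t 1) (Q' t 1) by rewrite -e -e'.
  rewrite proj_eq // => /eqP par.
  transitivity (linf (P t 1) (Q t 1) w * linf (P' t 1) (Q' t 1) w').
    by rewrite H H'_1; ring.
  transitivity (linf (P t 1) (Q t 1) w' * linf (P' t 1) (Q' t 1) w); last first.
    by rewrite H' H_1; ring.
  apply/eqP; rewrite -subr_eq0 /linf; apply/eqP.
  transitivity ((P t 1 * Q' t 1 - P' t 1 * Q t 1) * (hx w * hy w' - hx w' * hy w)).
    by ring.
  by rewrite par subrr mul0r.
(* The fibres over [w] and [w'] are disjoint, so the permutation of the concatenations restricts to
   each of them. *)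
apply/allP => a _ /=; have /seq.permP/(_ (pred1 a)) := pm; rewrite !count_cat.
have [Fa|Fa] := eqVneq (F a) w.
  have z1 E : isfib d F E -> count_mem a (E w') = 0%N.
    move=> fE; apply/count_memPn; rewrite (mem_fib fE) Fa eq_sym; exact: ww'.
  by rewrite (z1 D) // (z1 D') // addn0 add0n => ->.
have z1 E : isfib d F E -> count_mem a (E w) = 0%N.
  by move=> fE; apply/count_memPn; rewrite (mem_fib fE).
by rewrite (z1 D) // (z1 D').
Qed.

(** The local degree of [F] at [a], read off as a multiplicity in the fibre through [a]. *)
Definition mult D F a := count_mem a (D (F a)).

(** As F o g = F, the images of the fibres under the inverse of [g] are again fibres of [F], and
    fibres are unique. *)
Lemma mult_deck d F D g a : isfib d F D -> isMob g -> F \o g = F ->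
  mult D F (g a) = mult D F a.
Proof.
move=> fD gM Fg; have [h [hM gh hg]] := isMob_inv gM.
have := isfib_comp fD (isfib_mob gM gh); rewrite Fg muln1 => fD'.
rewrite /mult (congr1 (@^~ a) Fg : F (g a) = F a).
rewrite (seq.permP (isfib_uniq (F a) fD fD') (pred1 a)).
have -> : flatten [seq [:: h b] | b <- D (F a)] = [seq h b | b <- D (F a)].
  by elim: (D _) => //= b s ->.
rewrite count_map; apply: eq_count => b /=.
by apply/eqP/eqP => [->|<-]; [exact: (congr1 (@^~ a) hg)|exact: (esym (congr1 (@^~ b) gh))].
Qed.

(** The chain rule: [a] occurs only in the block [D' (F' a)], the other blocks being fibres over
    other points. *)
Lemma mult_comp d d' F F' D D' a : isfib d F D -> isfib d' F' D' ->
  mult (fun w => flatten [seq D' b | b <- D w]) (F \o F') a =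
  (mult D F (F' a) * mult D' F' a)%N.
Proof.
move=> fD fD'; rewrite /mult /=.
elim: (D _) => //= b s IH; rewrite count_cat IH mulnDl; congr addn.
have [<-|ne] := eqVneq b (F' a); first by rewrite mul1n.
by apply/count_memPn; rewrite (mem_fib fD') eq_sym.
Qed.

Lemma mult_mob g h a : h \o g = id -> mult (fun w => [:: h w]) g a = 1%N.
Proof. by move=> hg; rewrite /mult /= (congr1 (@^~ a) hg : h (g a) = a) eqxx. Qed.

(** In a target coordinate sending F 0 to 0 and [w'] to infinity, F is a multiple of z^m v / u with
    u and v nonzero at 0. Comparing F (r z) with F z, cancelling z^m and setting z = 0 yields r^m =
    1. *)
Lemma mult_scal d F D r : isfib d F D -> F \o scal r = F ->
  r ^+ mult D F (Some 0) = 1.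
Proof.
move=> fD Fr; have [w' ww'] := exists_neq (F (Some 0)).
have [P [Q [H1 H2]]] := fD.
set w := F (Some 0) in ww'; have [_ [c c0 H]] := H2 w; have [_ [c1 c10 H_1]] := H2 w'.
pose u := \prod_(a <- D w' ) linp a.
pose v := \prod_(a <- [seq a <- D w | a != Some 0]) linp a.
set m := mult _ _ _.
have ev : \prod_(a <- D w) linp a = 'X^m * v.
  rewrite /v /m /mult -/w; elim: (D w) => [|a s IH] /=.
    by rewrite !big_nil expr0 mulr1.
  rewrite big_cons IH; have [->|a0] /= := eqVneq a (Some 0).
    by rewrite subr0 exprS mulrA.
  by rewrite big_cons add0n mulrCA.
have nz0 (s : seq (option K)) : Some 0 \notin s -> (\prod_(a <- s) linp a).[0] != 0.
  rewrite -linf_prod_horner; elim: s => [|a s IH]; rewrite ?big_nil ?oner_eq0 //.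
  rewrite inE negb_or big_cons => /andP[a0 /IH {}IH]; rewrite mulf_neq0 //.
  by rewrite linf_eq0 ?nonzero2_1 // /proj oner_eq0 mul0r.
have u0 : u.[0] != 0 by apply: nz0; rewrite (mem_fib fD) -/w eq_sym.
have v0 : v.[0] != 0 by apply: nz0; rewrite mem_filter eqxx.
(* The factor 'X makes the identity trivial at t = 0, where t ^+ m might not be cancellable. *)
have E : 'X * (r ^+ m *: ((v \Po (r *: 'X)) * u) - v * (u \Po (r *: 'X))) = 0.
  apply: horner_ext => t; rewrite horner0.
  have [->|t0] := eqVneq t 0; first by rewrite hornerM hornerX mul0r.
  have [nz e] := H1 _ _ (nonzero2_1 t); have [nz' e'] := H1 _ _ (nonzero2_1 (r * t)).
  have /eqP : proj (P (r * t) 1) (Q (r * t) 1) = proj (P t 1) (Q t 1).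
    rewrite -e -e' -[in RHS]Fr /= {1 2}/proj oner_eq0 !divr1 scalE //.
  rewrite proj_eq // => /eqP par.
  have par2 : linf (P (r * t) 1) (Q (r * t) 1) w * linf (P t 1) (Q t 1) w' =
     linf (P t 1) (Q t 1) w * linf (P (r * t) 1) (Q (r * t) 1) w'.
    apply/eqP; rewrite -subr_eq0 /linf; apply/eqP.
    transitivity ((P (r * t) 1 * Q t 1 - P t 1 * Q (r * t) 1) * (hx w * hy w' - hx w' * hy w)).
      by ring.
    by rewrite par subrr mul0r.
  move: par2; rewrite !H !H_1 !linf_prod_horner !ev -/u !hornerM !hornerXn => par2.
  rewrite hornerD hornerN hornerZ !hornerM !horner_comp !hornerZ !hornerX.
  have k0 : c * c1 * t ^+ m != 0 by rewrite !mulf_neq0 // expf_neq0.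
  apply: (mulfI k0); rewrite mulr0.
  transitivity (t * (c * ((r * t) ^+ m * v.[r * t]) * (c1 * u.[t]) -
      c * (t ^+ m * v.[t]) * (c1 * u.[r * t]))).
    by rewrite exprMn; ring.
  by rewrite par2 subrr mulr0.
move/eqP: E; rewrite mulf_eq0 polyX_eq0 /= => /eqP/(congr1 (horner^~ 0)).
rewrite hornerD hornerN hornerZ !hornerM !horner_comp !hornerZ !hornerX mulr0 horner0.
move=> /eqP; rewrite subr_eq0 => /eqP; apply: contra_eq => rm.
by rewrite -subr_eq0 -[X in _ - X]mul1r -mulrBl !mulf_neq0 // subr_eq0.
Qed.

(** All natural numbers would lie in a single fibre, which has only [d] entries. *)
Lemma deck_translation d F D : isfib d F D -> F \o mob 1 1 0 1 <> F.
Proof.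
move=> fD FT.
have Fn (n : nat) : F (Some n%:R) = F (Some 0).
  rewrite -iter_translation; elim: n => //= n <-.
  exact: (congr1 (@^~ _) FT).
have [P [Q [_ H2]]] := fD; have [sz _] := H2 (F (Some 0)).
pose s := [seq Some (n%:R : K) | n <- iota 0 d.+1].
suff : (size s <= size (D (F (Some 0%R))))%N by rewrite size_map size_iota sz ltnn.
apply: uniq_leq_size.
  by rewrite map_inj_uniq ?iota_uniq // => m n [] /eqP; rewrite eqr_nat => /eqP.
by move=> _ /mapP[n _ ->]; rewrite (mem_fib fD) Fn.
Qed.

(* A Moebius deck transformation is diagonalizable, and near a fixed point of
   local degree [m] it acts as a rotation of order dividing [m]. *)
Lemma deck_order d F D g n : isfib d F D -> isMob g -> F \o g = F ->
  (forall a, (mult D F a %| n)%N) -> iter n g = id.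
Proof.
move=> fD gM Fg dv.
have [h [h' [hM h'M hK h'K gE]]] := isMob_normal_form gM.
have fDh := isfib_comp fD (isfib_mob hM hK).
have hh' z : h (h' z) = z by exact: (congr1 (@^~ z) hK).
have h'h z : h' (h z) = z by exact: (congr1 (@^~ z) h'K).
case: gE => [[r r0 e]|e]; last first.
  case: (deck_translation fDh).
  by rewrite -[in RHS]Fg e; apply: funext => z /=; rewrite h'h.
have Fr : (F \o h) \o scal r = F \o h.
  by rewrite -[in RHS]Fg e; apply: funext => z /=; rewrite h'h.
have := mult_scal fDh Fr; rewrite (mult_comp _ fD (isfib_mob hM hK)).
rewrite mult_mob // muln1 => rm.
have -> : iter n g = h \o iter n (scal r) \o h'.
  elim: n {dv} => [|n IH]; apply: funext => z /=; first by rewrite hh'.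
  by rewrite IH e /= h'h.
have /dvdnP[k ->] := dv (h (Some 0)).
by rewrite iter_scal mulnC exprM rm expr1n scal1; exact: hK.
Qed.

End Fibers.

(** * Visits to two marked points *)

Section CriticalVisits.
Local Open Scope nat_scope.
Variables (T : eqType) (f : T -> T).
Implicit Types (x y c : T) (k n t : nat).

(** The disjunction counts each time once, so that [visits c c] counts the visits to a single
    point. *)
Definition visits c1 c2 k x :=
  \sum_(0 <= t < k) ((iter t f x == c1) || (iter t f x == c2) : nat).

Definition periodic c := exists2 n, 0 < n & iter n f c = c.

Lemma visitsC c1 c2 k x : visits c1 c2 k x = visits c2 c1 k x.
Proof. by apply: eq_bigr => t _; rewrite orbC. Qed.

Lemma visitsD c1 c2 a b x :
  visits c1 c2 (a + b) x = visits c1 c2 a x + visits c1 c2 b (iter a f x).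
Proof.
rewrite /visits (@big_cat_nat _ _ _ a) ?leq_addr //=; congr addn.
rewrite -{1}[a]add0n big_addn addnC addnK; apply: eq_bigr => t _.
by rewrite iterD.
Qed.

Lemma visits1 c1 c2 x : visits c1 c2 1 x = (x == c1) || (x == c2).
Proof. by rewrite /visits big_nat1. Qed.

Lemma visits_eq0 c1 c2 k x : visits c1 c2 k x = 0 -> forall t, t < k ->
  (iter t f x == c1) || (iter t f x == c2) = false.
Proof.
move=> e t tk; move: e; rewrite -(subnKC tk) -addn1 visitsD visitsD visits1.
by case: (_ || _) => //=; rewrite addn1 addSn.
Qed.

Lemma visits_gt0 c1 c2 k x : 0 < visits c1 c2 k x ->
  exists2 t, t < k & (iter t f x == c1) || (iter t f x == c2).
Proof.
elim: k => [|k IH]; first by rewrite /visits big_nil.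
rewrite -[k.+1]addn1 visitsD visits1.
case E: (_ || _); first by exists k; rewrite // addn1.
by rewrite addn0 => /IH[t tk h]; exists t; rewrite // addn1 ltnS ltnW.
Qed.

Lemma visits_le1 c k x : ~ periodic c -> visits c c k x <= 1.
Proof.
move=> np; elim: k x => [|k IH] x; first by rewrite /visits big_nil.
rewrite -[k.+1]add1n visitsD visits1 orbb.
have [ex|_] := eqVneq x c; last by rewrite add0n.
rewrite [X in _ + X](_ : _ = 0) //; apply/eqP; rewrite eqn0Ngt; apply/negP.
case/visits_gt0 => t _; rewrite orbb -iterD addn1 ex => /eqP e.
by apply: np; exists t.+1.
Qed.

Lemma visits_leD c1 c2 k x : visits c1 c2 k x <= visits c1 c1 k x + visits c2 c2 k x.
Proof.
rewrite /visits -big_split; apply: leq_sum => t _ /=; rewrite !orbb.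
by case: (_ == c1); case: (_ == c2).
Qed.

Lemma visits_le2 c1 c2 k x : ~ periodic c1 -> ~ periodic c2 -> visits c1 c2 k x <= 2.
Proof.
move=> np1 np2; apply: leq_trans (visits_leD _ _ _ _) _.
by rewrite -[2]/(1 + 1) leq_add ?visits_le1.
Qed.

Lemma visits_avoid c1 c2 k x : (forall t, t < k -> iter t f x != c1) ->
  visits c1 c2 k x = visits c2 c2 k x.
Proof.
by move=> h; apply: eq_big_nat => t /andP[_ tk]; rewrite orbb (negPf (h t tk)).
Qed.

Lemma first_meeting k x y : iter k f x = iter k f y -> exists a, [/\ a <= k,
  iter a f x = iter a f y & forall t, t < a -> iter t f x != iter t f y].
Proof.
move=> e; have ex : exists t, iter t f x == iter t f y by exists k; apply/eqP.
case: (ex_minnP ex) => a /eqP ea mn; exists a; split => //.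
  by apply: mn; apply/eqP.
by move=> t ta; apply/negP => /mn; rewrite leqNgt ta.
Qed.

(** The orbits coincide from time [a] on, so the difference of the two counts is settled by then;
    the form with sums avoids truncated subtraction. *)
Lemma visits_meeting c1 c2 a k x y : a <= k -> iter a f x = iter a f y ->
  visits c1 c2 k x + visits c1 c2 a y = visits c1 c2 k y + visits c1 c2 a x.
Proof.
move=> ak e; rewrite -(subnKC ak) !visitsD e addnAC [RHS]addnAC.
by congr addn; rewrite addnC.
Qed.

(** The orbit of [y] is that of [x] advanced by k steps. If [x] is at [c] at time t, then so is [y],
    because f^k fixes [c]. *)
Lemma avoid_periodic k c x y t : iter k f c = c -> iter k f x = y ->
  iter t f x != iter t f y -> iter t f x != c.
Proof.
move=> ec ex; apply: contra_neq => et.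
by rewrite -ex -iterD addnC iterD et ec.
Qed.

Lemma iter_period n k x : iter n f x = x -> iter (k * n) f x = x.
Proof. by move=> e; elim: k => //= k IH; rewrite mulSn iterD IH. Qed.

Lemma iter_mod n k x : iter n f x = x -> iter (k %% n) f x = iter k f x.
Proof. by move=> e; rewrite {2}(divn_eq k n) addnC iterD iter_period. Qed.

(* If [x] and the periodic point [y] have the same image under [f^k], then before
   meeting the orbit of [y] the orbit of [x] contains no periodic point. Comparing
   visits with [y = c1] shows that an [x] not equal to [c1] runs through [c2] at a time
   [b] before the first return of [c1]; when [b > 0], the point [c2] in turn is
   determined by its visits. *)
Lemma critical_characterized c1 c2 k : periodic c1 -> exists K, k <= K /\
  exists2 c, c = c1 \/ c = c2 & forall x, iter K f x = iter K f c ->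
    visits c1 c2 K x = visits c1 c2 K c -> (x == c1) || (x == c2).
Proof.
move=> [n n0 en]; have [[m m0 em]|np2] := pselect (periodic c2).
  (* A common multiple of both periods, so that f^K fixes [c1] and [c2]. *)
  pose K := k * (n * m); exists K; split; first by rewrite leq_pmulr // muln_gt0 n0.
  have K1 : iter K f c1 = c1 by rewrite /K [n * m]mulnC mulnA iter_period.
  have K2 : iter K f c2 = c2 by rewrite /K mulnA iter_period.
  exists c1; first by left.
  rewrite K1 => x ex; have [] := @first_meeting K x c1; first by rewrite K1.
  move=> [|a] [aK ea mn]; first by move: ea => /= -> _; rewrite eqxx.
  move=> ev; have := visits_meeting c1 c2 aK ea; rewrite ev => /addnI.
  rewrite -[in visits _ _ _ c1]add1n visitsD visits1 eqxx /= => e1.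
  (* The point [c1] counts itself at time 0, so [x] must meet a critical point before the meeting
     time; but both are periodic and hence avoided. *)
  have : 0 < visits c1 c2 a.+1 x by rewrite -e1.
  case/visits_gt0 => t ta /orP[] /eqP tc.
    by have := avoid_periodic K1 ex (mn t ta); rewrite tc eqxx.
  by have := avoid_periodic K2 ex (mn t ta); rewrite tc eqxx.
pose K := k.+1 * n; exists K; split.
  by apply: leq_trans (leqnSn k) _; rewrite leq_pmulr.
have K1 : iter K f c1 = c1 by rewrite /K iter_period.
apply: contrapT => nP.
have [z [ez vz]] : exists z, [/\ iter K f z = c1, visits c1 c2 K z = visits c1 c2 K c1 &
    ~~ ((z == c1) || (z == c2))].
  apply: contrapT => nz; apply: nP; exists c1; first by left.
  rewrite K1 => x ex ev; apply: contrapT => /negP nx; apply: nz.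
  by exists x.
rewrite negb_or => /andP[zc1 zc2].
have [] := @first_meeting K z c1; first by rewrite K1.
move=> [|a] [aK ea mn]; first by move/eqP: ea; rewrite (negPf zc1).
(* Before the meeting [z] avoids [c1] and meets [c2] at most once, while [c1] counts itself. Hence
   both counts up to time [a.+1] are exactly 1. *)
have := visits_meeting c1 c2 aK ea; rewrite vz => /addnI.
rewrite (@visits_avoid _ _ _ z); last first.
  by move=> t /mn; apply: avoid_periodic K1 ez.
have := @visits_le1 c2 a.+1 z np2.
rewrite -[in visits c1 _ _ _]add1n visitsD visits1 eqxx add1n => + e1.
rewrite -e1 ltnS leqn0 => /eqP v0.
have /visits_gt0[b ba] : 0 < visits c2 c2 a.+1 z by rewrite -e1.
rewrite orbb => /eqP zb.
have b0 : 0 < b by case: b zb {ba} => // /eqP; rewrite (negPf zc2).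
have bK : b < K by exact: leq_trans ba aK.
apply: nP; exists c2; first by right.
pose y := iter b f c1.
have Kc2 : iter K f c2 = y by rewrite -zb -iterD addnC iterD ez.
have Ky : iter K f y = y by rewrite /y -iterD addnC iterD K1.
have vy t : t < a.+1 - b -> (iter t f y == c1) || (iter t f y == c2) = false.
  move=> tab; rewrite /y -iterD.
  have tb : (t + b).-1.+1 = t + b by rewrite prednK // addn_gt0 b0 orbT.
  rewrite -tb -addn1 iterD; apply: (visits_eq0 v0).
  by rewrite -ltnS tb addnC -ltn_subRL.
rewrite Kc2 => x ex ev.
(* The orbits of [c2] and [y] are those of [z] and [c1] after b steps, so they meet at time a.+1 -
   b. Until then [y] has no visit, whereas [c2] counts itself. *)
have vc2 : visits c1 c2 K y < visits c1 c2 K c2.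
  have abK : a.+1 - b <= K by rewrite leq_subLR (leq_trans aK) // leq_addl.
  have em : iter (a.+1 - b) f c2 = iter (a.+1 - b) f y.
    by rewrite -zb /y -!iterD subnK // ltnW.
  have := visits_meeting c1 c2 abK em.
  have -> : visits c1 c2 (a.+1 - b) y = 0.
    apply/eqP; rewrite eqn0Ngt; apply/negP => /visits_gt0[t tab].
    by rewrite vy.
  rewrite addn0 => ->; rewrite -[X in X < _]addn0 ltn_add2l.
  rewrite subSn // -[in visits _ _ _ _]add1n visitsD visits1 eqxx orbT.
  by [].
have [] := @first_meeting K x y; first by rewrite Ky.
move=> d [dK ed mnd].
have := visits_meeting c1 c2 dK ed; rewrite ev => em.
have : visits c1 c2 d y < visits c1 c2 d x.
  by rewrite -(ltn_add2l (visits c1 c2 K c2)) em ltn_add2r.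
have ->: visits c1 c2 d x = visits c2 c2 d x.
  by apply: visits_avoid => t /mnd; apply: avoid_periodic K1 ex.
move=> vd; have := leq_trans vd (visits_le1 d x np2).
rewrite ltnS leqn0 => /eqP vy0.
have /visits_gt0[e ed'] := leq_ltn_trans (leq0n _) vd; rewrite orbb => /eqP xe.
(* Advancing the visit of [x] to [c2] at time e by K steps shows that e is a period of [y]. *)
have ey : iter e f y = y by rewrite -[in LHS]ex -iterD addnC iterD xe.
have [e0|e0] := posnP e; first by rewrite -xe e0 /= eqxx orbT.
(* The orbit of [y] contains [c1]; reducing the time modulo the period e gives a visit before time
   d, where [y] has none. *)
have ec : iter (K - b) f y = c1 by rewrite /y -iterD subnK // ltnW.
have := visits_eq0 vy0 (ltn_trans (ltn_pmod (K - b) e0) ed').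
by rewrite iter_mod // ec eqxx.
Qed.

End CriticalVisits.

(** * Presentations by rotations and flips *)

Section Presentations.
Variables (gT : finGroupType) (x y : gT) (N : nat).
Hypotheses (N1 : (1 < N)%N) (xN : (x ^+ N = 1)%g) (y2 : (y ^+ 2 = 1)%g)
  (xy : (x ^ y = x^-1)%g) (gen : (<[x]> <*> <[y]> = [set: gT])%g) (card : #|gT| = (2 * N)%N).

Lemma dihedral_normal_form (g : gT) : exists ij : 'I_N * 'I_2, (g = x ^+ ij.1 * y ^+ ij.2)%g.
Proof.
have : g \in (<[x]> <*> <[y]>)%g by rewrite gen inE.
rewrite norm_joinEr; last by rewrite norms_cycle xy groupV cycle_id.
case/mulsgP => _ _ /cycleP[i ->] /cycleP[j ->] ->.
exists (Ordinal (ltn_pmod i (ltnW N1)), Ordinal (ltn_pmod j (isT : 0 < 2)%N)) => /=.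
by rewrite !expg_mod.
Qed.

(** The normal form maps 2N exponent pairs onto a group of order 2N, so it is injective. *)
Lemma dihedral_normal_form_inj (i j i' j' : nat) :
  (x ^+ i * y ^+ j = x ^+ i' * y ^+ j')%g -> i = i' %[mod N] /\ j = j' %[mod 2].
Proof.
pose m (ij : 'I_N * 'I_2) := (x ^+ ij.1 * y ^+ ij.2)%g.
have inj : injective m.
  have im : m @: setT = setT.
    apply/setP => g; rewrite inE; apply/imsetP.
    by have [ij e] := dihedral_normal_form g; exists ij.
  have /imset_injP inj : #|m @: setT| == #|[set: 'I_N * 'I_2]|.
    by rewrite im !cardsT card card_prod !card_ord mulnC.
  by move=> a b; apply: inj; rewrite inE.
have n0 := ltnW N1.
move=> e; have : m (Ordinal (ltn_pmod i n0), Ordinal (ltn_pmod j (isT : 0 < 2)%N)) =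
  m (Ordinal (ltn_pmod i' n0), Ordinal (ltn_pmod j' (isT : 0 < 2)%N)).
  by rewrite /m /= !expg_mod.
by move/inj => -[].
Qed.

(** In natural exponents [N.-1] stands for -1 modulo N: moving y^j past x^k multiplies k by
    (-1)^j. *)
Lemma dihedral_mul (i j k l : nat) :
  (x ^+ i * y ^+ j * (x ^+ k * y ^+ l) = x ^+ (i + k * N.-1 ^ j) * y ^+ (j + l))%g.
Proof.
have yx n : (y * x ^+ n = x ^+ (n * N.-1) * y)%g.
  have -> : (x ^+ (n * N.-1) = (x ^+ n)^-1)%g.
    apply/eqP; rewrite eq_sym eq_invg_mul -expgD -{1}[n]muln1 -mulnDr add1n prednK ?(ltnW N1) //.
    by rewrite mulnC expgM xN expg1n.
  have yy : (y * y = 1)%g by rewrite -y2 expgS expg1.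
  have yV : (y^-1 = y)%g by apply/eqP; rewrite eq_invg_mul yy.
  have e : ((x ^+ n) ^ y = (x ^+ n)^-1)%g by rewrite conjXg xy expgVn.
  by rewrite -e conjgE yV -!mulgA yy mulg1.
have yjx : (y ^+ j * x ^+ k = x ^+ (k * N.-1 ^ j) * y ^+ j)%g.
  elim: j => [|j IH]; first by rewrite expg0 mulg1 mul1g expn0 muln1.
  by rewrite expgS -mulgA IH mulgA yx -mulgA -expgS -mulnA expnSr.
by rewrite -mulgA [(y ^+ j * _)%g]mulgA yjx !expgD !mulgA.
Qed.

End Presentations.

Lemma group_iso_conj (gT : finGroupType) X (S S' : (X -> X) -> Prop) h h' :
  h \o h' = id -> h' \o h = id -> (forall t, S t <-> S' (h' \o t \o h)) ->
  group_iso_to gT S' -> group_iso_to gT S.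
Proof.
move=> hK h'K SS' [phi [inj morph im]].
have hh' z : h (h' z) = z by exact: (congr1 (@^~ z) hK).
have h'h z : h' (h z) = z by exact: (congr1 (@^~ z) h'K).
exists (fun g => h \o phi g \o h'); split.
- move=> g g' e; apply: inj; apply: funext => z.
  by have := congr1 (fun t => h' (t (h z))) e; rewrite /= !h'h.
- by move=> g g'; rewrite morph; apply: funext => z /=; rewrite h'h.
move=> t; rewrite SS' im; split=> -[g e]; exists g; last first.
  by rewrite -e; apply: funext => z /=; rewrite !h'h.
by rewrite e; apply: funext => z /=; rewrite !hh'.
Qed.

Section Classification.
Variable K : numClosedFieldType.
Implicit Types (a b c d : K) (S : (option K -> option K) -> Prop).

Lemma prim_root_2exp n (z : K) : z ^+ (2 ^ n) = -1 -> (2 ^ n.+1).-primitive_root z.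
Proof.
move=> e; have e1 : z ^+ (2 ^ n.+1) = 1 by rewrite expnSr exprM e sqrrN expr1n.
have [m pm /dvdn_pfactor] := prim_order_exists (expn_gt0 2 n.+1 : _ = true) e1.
move=> /(_ isT)[j jn em]; rewrite em in pm.
have [jn'|jn'] := leqP j n; last first.
  by have <- : j = n.+1 by apply/eqP; rewrite eqn_leq jn.
have /eqP : z ^+ (2 ^ n) = 1.
  by apply/eqP; rewrite -(prim_order_dvd pm) dvdn_exp2l.
by rewrite e -subr_eq0 -opprD oppr_eq0 -[1 + 1]/(2%:R) pnatr_eq0.
Qed.

Lemma scal_neq_flip a b : scal a <> flip b.
Proof. by move=> /(congr1 (@^~ None)); rewrite scal_inf flip_inf. Qed.

Lemma flip_inj a b : flip a = flip b -> a = b.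
Proof.
move=> /(congr1 (@^~ (Some 1))); rewrite /flip /mob /proj /=.
by rewrite !(mul0r, mulr0, mulr1, add0r, addr0) oner_eq0 !divr1 => -[].
Qed.

Lemma cyclic_iso N (z : K) S : (1 < N)%N -> N.-primitive_root z ->
  (forall t, S t <-> exists i : nat, t = scal (z ^+ i)) ->
  group_iso_to ('Z_N : finGroupType) S.
Proof.
move=> N1 pz SE; exists (fun i : 'Z_N => scal (z ^+ i)); split.
- move=> i j /scal_inj /eqP; rewrite (eq_prim_root_expr pz) => /eqP e.
  apply: val_inj; move: e; rewrite !modn_small //; [have := ltn_ord j|have := ltn_ord i];
  by rewrite [X in (_ < X)%N -> _]Zp_cast.
- move=> i j; rewrite scal_comp -exprD; congr scal.
  by rewrite -[RHS](prim_expr_mod pz) /=; congr (_ ^+ (_ %% _)); exact: Zp_cast.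
move=> t; rewrite SE; split=> -[i e]; last by exists i.
exists (inZp i); rewrite e /= Zp_cast //.
by rewrite (prim_expr_mod pz).
Qed.

(** Abstract elements and maps are both indexed by exponent pairs modulo N and 2, with the same
    multiplication law ([dihedral_mul] and [Phi_mul]), so matching normal forms is an
    isomorphism. *)
Lemma dihedral_iso (gT : finGroupType) (x y : gT) N (z : K) b S :
  (1 < N)%N -> (x ^+ N = 1)%g -> (y ^+ 2 = 1)%g -> (x ^ y = x^-1)%g ->
  (<[x]> <*> <[y]> = [set: gT])%g -> #|gT| = (2 * N)%N ->
  N.-primitive_root z -> b != 0 ->
  (forall t, S t <-> exists i : nat, t = scal (z ^+ i) \/ t = flip (z ^+ i * b)) ->
  group_iso_to gT S.
Proof.
move=> N1 xN y2 xy gen card pz b0 SE.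
have z0 : z != 0 by rewrite (prim_root_eq0 pz) -lt0n ltnW.
have zn0 n : z ^+ n != 0 by rewrite expf_neq0.
pose Phi (i j : nat) := scal (z ^+ i) \o iter j (flip b).
have ff : iter 2 (flip b) = id.
  by rewrite -[LHS]/(flip b \o flip b) flip_flip // divff // scal1.
have Phi_mod i j i' j' : i = i' %[mod N] -> j = j' %[mod 2] -> Phi i j = Phi i' j'.
  have H k l : Phi k l = Phi (k %% N)%N (l %% 2)%N.
    rewrite /Phi (prim_expr_mod pz); congr (_ \o _); apply: funext => w.
    by rewrite iter_mod // ff.
  by move=> ei ej; rewrite H ei ej -H.
have Phi_inj i j i' j' : Phi i j = Phi i' j' -> i = i' %[mod N] /\ j = j' %[mod 2].
  have E k l : Phi k l = if odd l then flip (z ^+ k * b) else scal (z ^+ k).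
    rewrite (Phi_mod k l k (odd l)) ?modn2 ?oddb // /Phi; case: (odd l) => //=.
    by rewrite -scal_flip.
  rewrite !E !modn2; case: (odd j); case: (odd j').
  - by move=> /flip_inj /(mulIf b0) /eqP; rewrite (eq_prim_root_expr pz) => /eqP.
  - by move=> /esym /scal_neq_flip.
  - by move=> /scal_neq_flip.
  - by move=> /scal_inj /eqP; rewrite (eq_prim_root_expr pz) => /eqP.
have Phi_mul i j k l : Phi i j \o Phi k l = Phi (i + k * N.-1 ^ j)%N (j + l)%N.
  have fz n : flip b \o scal (z ^+ n) = scal (z ^+ (n * N.-1)) \o flip b.
    rewrite flip_scal // scal_flip //; congr flip; apply: (mulIf (zn0 n)).
    rewrite divfK // mulrAC -exprD -{2}[n]muln1 -mulnDr addn1 prednK ?(ltnW N1) //.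
    by rewrite mulnC exprM (prim_expr_order pz) expr1n mul1r.
  have fjz : iter j (flip b) \o scal (z ^+ k) = scal (z ^+ (k * N.-1 ^ j)) \o iter j (flip b).
    elim: j => [|j IH]; first by rewrite expn0 muln1.
    have -> : iter j.+1 (flip b) = flip b \o iter j (flip b) by [].
    by rewrite -compA IH compA fz expnSr mulnA.
  rewrite /Phi -compA (compA (iter j _)) fjz exprD -scal_comp -!compA.
  by do 2!congr (_ \o _); apply: funext => w /=; rewrite iterD.
pose phi g := let ij := sval (cid (dihedral_normal_form N1 xN y2 xy gen g)) in Phi ij.1 ij.2.
have phiE i j : phi (x ^+ i * y ^+ j)%g = Phi i j.
  rewrite /phi; case: cid => -[i0 j0] /= e.
  have [ei ej] := dihedral_normal_form_inj N1 xN y2 xy gen card e.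
  by rewrite (Phi_mod _ _ _ _ ei ej).
exists phi; split.
- move=> g g'; have [[i j] ->] := dihedral_normal_form N1 xN y2 xy gen g.
  have [[i' j'] ->] := dihedral_normal_form N1 xN y2 xy gen g' => /=.
  rewrite !phiE => /Phi_inj[]; rewrite !modn_small // => -> ->.
  by [].
- move=> g g'; have [[i j] ->] := dihedral_normal_form N1 xN y2 xy gen g.
  have [[i' j'] ->] := dihedral_normal_form N1 xN y2 xy gen g' => /=.
  by rewrite (dihedral_mul N1 xN y2 xy) !phiE Phi_mul.
move=> t; rewrite SE; split.
  move=> [i [->|->]]; first by exists (x ^+ i * y ^+ 0)%g; rewrite phiE.
  by exists (x ^+ i * y ^+ 1)%g; rewrite phiE /Phi /= scal_flip.
move=> [g <-]; have [[i j] ->] := dihedral_normal_form N1 xN y2 xy gen g.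
rewrite phiE /=; exists (i : nat); case: j => -[|[|//]] j2; [left|right] => //.
by rewrite /Phi /= scal_flip.
Qed.

(** The group V_4 is the dihedral case N = 2, where inverting [x] changes nothing. *)
Lemma klein_iso b S : b != 0 ->
  (forall t, S t <-> exists i : nat, t = scal ((-1) ^+ i) \/ t = flip ((-1) ^+ i * b)) ->
  group_iso_to Klein4 S.
Proof.
move=> b0 SE; pose x : Klein4 := (1, 0); pose y : Klein4 := (0, 1).
apply: (@dihedral_iso Klein4 x y 2 (-1) b) => //.
- by apply/eqP.
- by apply/eqP.
- by apply/eqP.
- apply/setP => -[i j]; rewrite [RHS]inE.
  have -> : (i, j) = (x ^+ i * y ^+ j)%g.
    by apply/eqP; case: i => -[|[|//]] ?; case: j => -[|[|//]] ?.
  by rewrite groupM // groupX // mem_gen // inE cycle_id ?orbT.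
- by rewrite card_prod !card_ord.
- by apply: (@prim_root_2exp 0); rewrite expr1.
Qed.

Lemma D8_iso b S : b != 0 ->
  (forall t, S t <-> exists i : nat, t = scal ('i ^+ i) \/ t = flip ('i ^+ i * b)) ->
  group_iso_to Dihedral8 S.
Proof.
move=> b0 SE.
have /existsP[[x y] /=] : [set: Dihedral8] \homg Grp (x : y : x ^+ 4, y ^+ 2, x ^ y = x^-1)%g.
  by rewrite -(Grp_dihedral (isT : 1 < 4)%N) homg_refl.
rewrite !xpair_eqE /= => /andP[/eqP gen /and3P[/eqP x4 /eqP y2 /eqP xy]].
apply: (@dihedral_iso Dihedral8 x y 4 'i b) => //.
  by rewrite -cardsT [LHS](card_dihedral (isT : 1 < 4)%N).
by apply: (@prim_root_2exp 1); rewrite sqrCi.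
Qed.

End Classification.

(** * Moebius groups of exponent 4 *)

Section Exponent4.
Variable K : numClosedFieldType.
Implicit Types (a b c d : K) (S : (option K -> option K) -> Prop).

Lemma neg1_neq1 : (-1 : K) != 1.
Proof. by rewrite -subr_eq0 -opprD oppr_eq0 -[1 + 1]/(2%:R) pnatr_eq0. Qed.

(** For the matrix A of the map, Cayley-Hamilton gives A^4 = X A + scalar with X = tr A * tr A^2,
    and a^2 + d^2 + 2 b c is tr A^2. So if A^4 is scalar, then X = 0 or A is scalar. *)
Lemma iter4_mob a b c d : a * d - b * c != 0 -> iter 4 (mob a b c d) = id ->
  mob a b c d = id \/ a + d = 0 \/ a ^+ 2 + d ^+ 2 + 2 * (b * c) = 0.
Proof.
move=> D; set D2 := (a * a + b * c) * (c * b + d * d) - (a * b + b * d) * (c * a + d * c).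
have D20 : D2 != 0.
  by rewrite (_ : D2 = (a * d - b * c) ^+ 2) ?expf_neq0 // /D2; ring.
have e2 := mob_comp D D; have e4 := mob_comp D20 D20.
rewrite -[iter 4 _]/((mob a b c d \o mob a b c d) \o (mob a b c d \o mob a b c d)) e2 e4.
move/mob_eq_id => [].
  set D4 := _ - _; rewrite (_ : D4 = D2 ^+ 2) ?expf_neq0 // /D4 /D2; ring.
set X := (a + d) * (a ^+ 2 + d ^+ 2 + 2 * (b * c)) => eb ec ead.
have Xb : X * b = 0 by rewrite -eb /X; ring.
have Xc : X * c = 0 by rewrite -ec /X; ring.
have Xad : X * (a - d) = 0.
  move/eqP: ead; rewrite -subr_eq0 => /eqP <-; rewrite /X; ring.
have [/eqP|X0] := eqVneq X 0.
  by rewrite mulf_eq0 => /orP[] /eqP ->; right; [left|right].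
clearbody X; left; move/eqP: Xb; move/eqP: Xc; move/eqP: Xad.
rewrite !mulf_eq0 (negPf X0) /= subr_eq0 => /eqP ad /eqP c0 /eqP b0; subst d b c.
move: D; rewrite mul0r subr0 => D; rewrite mob_diag // divff ?scal1 //.
by apply: contra_neq D => ->; rewrite mul0r.
Qed.

Lemma sq2_mob a b c d : a * d - b * c != 0 -> mob a b c d \o mob a b c d = id ->
  b * (a + d) = 0 /\ c * (a + d) = 0.
Proof.
move=> D; rewrite mob_comp // => /mob_eq_id[].
  by rewrite (_ : _ - _ = (a * d - b * c) ^+ 2) ?expf_neq0 //; ring.
by move=> <- ec _; split; [ring|rewrite -ec; ring].
Qed.

(* The four maps ['i ^+ j * g] either are trivial or satisfy the trace equation of
   [iter4_mob], which leaves only [a = d = 0]. *)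
Lemma normalized_by_rotation4 S t : (forall t, S t -> isMob t) ->
  (forall t u, S t -> S u -> S (t \o u)) -> (forall t, S t -> iter 4 t = id) ->
  S (scal 'i) -> S t -> (exists j : nat, t = scal ('i ^+ j)) \/ exists2 b, b != 0 & t = flip b.
Proof.
move=> SM SC S4 Si St; have [a [b [c [d [D et]]]]] := SM _ St.
have i0 : 'i != 0 :> K by exact: neq0Ci.
have Sj j : S (scal ('i ^+ j) \o t).
  elim: j => [|j IH]; first by rewrite expr0 scal1.
  by rewrite exprS -scal_comp -compA; apply: SC.
have Ej j : scal ('i ^+ j) \o t = mob ('i ^+ j * a) ('i ^+ j * b) c d.
  rewrite et mob_comp //; last by rewrite mulr1 mul0r subr0 expf_neq0.
  by congr mob; ring.
have [[j ej]|nj] := pselect (exists j : nat, scal ('i ^+ j) \o t = id).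
  (* The exponent - j is written 3 j, since 'i has order 4. *)
  left; exists (j * 3)%N; have -> : t = scal ('i ^+ (j * 3)) \o (scal ('i ^+ j) \o t).
    rewrite compA scal_comp -exprD -{2}[j]muln1 -mulnDr mulnC exprM.
    by rewrite (_ : 'i ^+ (3 + 1) = 1) ?expr1n ?scal1 // -[(3 + 1)%N]/(2 * 2)%N exprM sqrCi sqrrN expr1n.
  by rewrite ej.
right; have T j : 'i ^+ j * a + d = 0 \/ ('i ^+ j * a) ^+ 2 + d ^+ 2 + 2 * ('i ^+ j * (b * c)) = 0.
  have D' : 'i ^+ j * a * d - 'i ^+ j * b * c != 0.
    by rewrite -!mulrA -mulrBr mulf_neq0 // expf_neq0.
  have := S4 _ (Sj j); rewrite Ej => /(iter4_mob D')[|].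
    by rewrite -Ej => e; case: nj; exists j.
  by rewrite -['i ^+ j * b * c]mulrA.
have i2 : 'i ^+ 2 = -1 :> K by exact: sqrCi.
have i3 : 'i ^+ 3 = - 'i :> K by rewrite exprS i2 mulrN1.
have two0 : (2 : K) != 0 by rewrite pnatr_eq0.
have i1 : 'i - 1 != 0 :> K.
  by apply: contra_neq neg1_neq1 => /eqP; rewrite subr_eq0 => /eqP e; rewrite -i2 e expr1n.
have i1' : 'i + 1 != 0 :> K.
  by apply: contra_neq neg1_neq1 => /eqP; rewrite addr_eq0 => /eqP e; rewrite -i2 e sqrrN expr1n.
(* With p = b c, the equations for j = 0, 2 read d = -+ a or a^2 + d^2 = -+ 2 p, and those for j =
   1, 3 read d = -+ 'i a or d^2 - a^2 = -+ 2 'i p. *)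
move: (T 0%N) (T 1%N) (T 2%N) (T 3%N); rewrite expr0 expr1 i2 i3 !mul1r => T0 T1 T2 T3.
have [a0 d0] : a = 0 /\ d = 0; last first.
  subst a d t; move: D; rewrite mul0r sub0r oppr_eq0 => D; exists (b / c).
    by move: D; rewrite !mulf_eq0 invr_eq0.
  by rewrite mob_antidiag.
move: (b * c) T0 T1 T2 T3 => p T0 T1 T2 T3.
have Z (k u : K) : k != 0 -> k * u = 0 -> u = 0.
  by move=> k0 /eqP; rewrite mulf_eq0 (negPf k0) => /eqP.
have Z2 (u : K) : u ^+ 2 = 0 -> u = 0 by move=> /eqP; rewrite expf_eq0 => /eqP.
case: T0 => [l0|q0].
  have ed : d = - a by apply/eqP; rewrite -addr_eq0 addrC l0.
  suff a0 : a = 0 by rewrite ed a0 oppr0.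
  subst d; case: T2 => [l2|q2]; first by apply: (Z (- 2)); rewrite ?oppr_eq0 // -l2; ring.
  case: T1 => [l1|q1]; first by apply: (Z _ _ i1); rewrite -l1; ring.
  have p0 : p = 0.
    apply: (Z (2 * 'i)); first by rewrite mulf_neq0.
    rewrite -q1 exprMn i2; ring.
  by apply: Z2; apply: (Z _ _ two0); rewrite -q2 p0; ring.
case: T2 => [l2|q2].
  have ed : d = a by apply/eqP; rewrite -subr_eq0 -l2; apply/eqP; ring.
  suff a0 : a = 0 by rewrite ed a0.
  subst d; case: T1 => [l1|q1]; first by apply: (Z _ _ i1'); rewrite -l1; ring.
  have p0 : p = 0.
    apply: (Z (2 * 'i)); first by rewrite mulf_neq0.
    rewrite -q1 exprMn i2; ring.
  by apply: Z2; apply: (Z _ _ two0); rewrite -q0 p0; ring.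
have p0 : p = 0.
  apply: (Z (2 * 2)); first by rewrite mulf_neq0.
  rewrite -[RHS]subr0 -{1}q0 -q2; ring.
have A0 : a ^+ 2 + d ^+ 2 = 0 by rewrite -q0 p0; ring.
suff B0 : d ^+ 2 - a ^+ 2 = 0.
  split; apply: Z2; apply: (Z _ _ two0).
    by rewrite -[RHS]subr0 -{1}A0 -B0; ring.
  by rewrite -[RHS]addr0 -{1}A0 -B0; ring.
case: T1 => [l1|q1]; last by rewrite -q1 p0 exprMn i2; ring.
have ed : d = - ('i * a) by apply/eqP; rewrite -addr_eq0 addrC l1.
case: T3 => [l3|q3]; last by rewrite -q3 p0 exprMn sqrrN i2; ring.
have a0 : a = 0.
  apply: (Z (- (2 * 'i))); first by rewrite oppr_eq0 mulf_neq0.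
  by rewrite -l3 ed; ring.
by rewrite ed a0; ring.
Qed.

(** Both t and z |-> - t z are involutions, so unless b = c = 0 both traces a + d and d - a
    vanish. *)
Lemma normalized_by_rotation2 S t : (forall t, S t -> isMob t) ->
  (forall t u, S t -> S u -> S (t \o u)) -> (forall t, S t -> t \o t = id) ->
  S (scal (-1)) -> S t ->
  (exists j : nat, t = scal ((-1) ^+ j)) \/ exists2 b, b != 0 & t = flip b.
Proof.
move=> SM SC S2 Si St; have [a [b [c [d [D et]]]]] := SM _ St.
have Sj := SC _ _ Si St; have t2 := S2 _ St; have := S2 _ Sj.
have -> : scal (-1) \o t = mob (- a) (- b) c d.
  rewrite et mob_comp //; last by rewrite mulr1 mul0r subr0 oppr_eq0 oner_eq0.
  by congr mob; ring.
have D' : - a * d - - b * c != 0 by rewrite mulNr mulNr -opprD oppr_eq0.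
move=> /(sq2_mob D'); rewrite et in t2; have [b1 c1] := sq2_mob D t2 => -[b2 c2].
have two0 : (2 : K) != 0 by rewrite pnatr_eq0.
have Z u : u * (a + d) = 0 -> u * (- a + d) = 0 -> u != 0 -> a = 0 /\ d = 0.
  move=> e1 e2 u0; split; apply/eqP.
    suff : u * (2 * a) == 0 by rewrite !mulf_eq0 (negPf u0) (negPf two0).
    by rewrite -[0](subrr 0) -{1}e1 -e2; apply/eqP; ring.
  suff : u * (2 * d) == 0 by rewrite !mulf_eq0 (negPf u0) (negPf two0).
  by rewrite -[0](addr0 0) -{1}e1 -e2; apply/eqP; ring.
have [[b0 c0]|bc] := pselect (b = 0 /\ c = 0).
  left; subst b c t; move: D; rewrite mul0r subr0 => D.
  move: t2; rewrite mob_diag // scal_comp -scal1 => /scal_inj /eqP.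
  rewrite -expr2 sqrf_eq1 => /orP[] /eqP ->; first by exists 0%N; rewrite expr0.
  by exists 1%N.
right; have [a0 d0] : a = 0 /\ d = 0.
  have [b0|/(Z _ b1)] := eqVneq b 0; last first.
    by apply; move: b2; rewrite mulNr => /eqP; rewrite oppr_eq0 => /eqP.
  by have [c0|/(Z _ c1 c2)//] := eqVneq c 0; case: bc.
subst a d t; move: D; rewrite mul0r sub0r oppr_eq0 => D; exists (b / c).
  by move: D; rewrite !mulf_eq0 invr_eq0.
by rewrite mob_antidiag.
Qed.

(** The composite of two flips in [S] is a rotation in [S], so their parameters differ by a power of
    [z]. *)
Lemma rotations_and_flips N (z : K) S : (0 < N)%N -> N.-primitive_root z ->
  (forall t, S t -> isMob t) -> (forall t u, S t -> S u -> S (t \o u)) -> S (scal z) ->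
  (forall t, S t -> (exists j : nat, t = scal (z ^+ j)) \/ exists2 b, b != 0 & t = flip b) ->
  (forall t, S t <-> exists i : nat, t = scal (z ^+ i)) \/
  exists2 b, b != 0 &
    forall t, S t <-> exists i : nat, t = scal (z ^+ i) \/ t = flip (z ^+ i * b).
Proof.
move=> N0 pz SM SC Sz Scase.
have z0 : z != 0 by rewrite (prim_root_eq0 pz) -lt0n.
have Szj j : S (scal (z ^+ j)).
  case: j => [|j].
    by rewrite expr0 -(prim_expr_order pz); case: (N) N0 => // n _;
      elim: n => [|n IH]; rewrite ?expr1 // exprS -scal_comp; apply: SC.
  by elim: j => [|j IH]; rewrite ?expr1 // exprS -scal_comp; apply: SC.
have [[b b0 Sb]|nb] := pselect (exists2 b, b != 0 & S (flip b)); last first.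
  left=> t; split; last by move=> [i ->].
  by move=> /[dup] St /Scase[//|[b b0 e]]; case: nb; exists b => //; rewrite -e.
right; exists b => // t; split.
  move=> /[dup] St /Scase[[i ->]|[b' b'0 e]]; first by exists i; left.
  have := SC _ _ St Sb; rewrite e flip_flip // => /Scase[[i /scal_inj ei]|]; last first.
    by move=> [b'' _ /scal_neq_flip].
  by exists i; right; rewrite -ei divfK.
move=> [i [->//|->]]; rewrite -scal_flip //; last by rewrite expf_neq0.
exact: SC.
Qed.

(** The coordinates diagonalize an element that is not an involution, if there is one, and otherwise
    any nontrivial element. The group then contains the rotation 'i or -1 respectively, which
    restricts all other elements to rotations and flips. *)
Theorem exponent4_classification S : (forall t, S t -> isMob t) ->
  (forall t u, S t -> S u -> S (t \o u)) -> (forall t, S t -> iter 4 t = id) ->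
  (exists2 t, S t & t <> id) ->
  exists gT : finGroupType, [/\ (#|gT| <= 8)%N,
    (exists2 n, (0 < n)%N & gT = 'Z_(2 ^ n) :> finGroupType) \/ gT = Klein4 \/ gT = Dihedral8
    & group_iso_to gT S].
Proof.
move=> SM SC S4 [tau St ntau].
have conj h h' : isMob h -> isMob h' -> h \o h' = id -> h' \o h = id ->
  let S' := fun t => S (h \o t \o h') in
  [/\ forall t, S t <-> S' (h' \o t \o h), forall t, S' t -> isMob t,
    forall t u, S' t -> S' u -> S' (t \o u) & forall t, S' t -> iter 4 t = id].
  move=> hM h'M hK h'K S'.
  have hh' z : h (h' z) = z by exact: (congr1 (@^~ z) hK).
  have h'h z : h' (h z) = z by exact: (congr1 (@^~ z) h'K).
  split.
  - move=> t; rewrite /S' (_ : h \o (h' \o t \o h) \o h' = t) //.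
    by apply: funext => z /=; rewrite !hh'.
  - move=> t /SM tM; rewrite (_ : t = h' \o (h \o t \o h') \o h).
      by apply: isMob_comp => //; apply: isMob_comp.
    by apply: funext => z /=; rewrite !h'h.
  - move=> t u St' Su'; have := SC _ _ St' Su'.
    rewrite /S' (_ : _ \o (h \o u \o h') = h \o (t \o u) \o h') //.
    by apply: funext => z /=; rewrite h'h.
  - move=> t /S4 e; apply: funext => z; have := congr1 (fun f => h' (f (h z))) e.
    by rewrite /= !h'h.
have [[r Sr r2]|S2] := pselect (exists2 r, S r & r \o r <> id).
  have [h [h' [hM h'M hK h'K rE]]] := isMob_normal_form (SM _ Sr).
  have [SS' S'M S'C S'4] := conj h h' hM h'M hK h'K.
  have h'h z : h' (h z) = z by exact: (congr1 (@^~ z) h'K).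
  have hh' z : h (h' z) = z by exact: (congr1 (@^~ z) hK).
  set S' := (fun t => S (h \o t \o h')) in SS' S'M S'C S'4.
  case: rE => [[a a0 e]|e]; last first.
    have := S'4 (mob 1 1 0 1); rewrite -e => /(_ Sr)/(congr1 (@^~ (Some 0))).
    by rewrite iter_translation => -[] /eqP; rewrite pnatr_eq0.
  have Sa : S' (scal a) by rewrite /S' -e.
  have a4 : a ^+ 4 = 1.
    by apply: scal_inj; rewrite scal1 -iter_scal; apply: S'4.
  have a2 : a ^+ 2 != 1.
    apply/eqP => a2; apply: r2; rewrite e.
    have s2 : scal a \o scal a = id by rewrite scal_comp -expr2 a2 scal1.
    apply: funext => z /=; rewrite h'h.
    by rewrite (congr1 (@^~ _) s2 : scal a (scal a _) = _) hh'.
  have Si : S' (scal 'i).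
    have : a ^+ 2 == -1.
      by have /eqP := a4; rewrite -[4%N]/(2 * 2)%N exprM sqrf_eq1 (negPf a2).
    rewrite -sqrCi eqf_sqr => /orP[] /eqP ea; first by rewrite -ea.
    have : S' (iter 3 (scal a)) by apply: (S'C _ _ Sa); apply: (S'C _ _ Sa).
    rewrite iter_scal ea exprS sqrrN sqrCi mulrN1 opprK.
    by [].
  have pi : 4.-primitive_root ('i : K) by apply: (@prim_root_2exp _ 1); rewrite sqrCi.
  have [ES|[b b0 ES]] := @rotations_and_flips 4 'i S' isT pi S'M S'C Si
    (fun t => @normalized_by_rotation4 S' t S'M S'C S'4 Si).
    exists ('Z_(2 ^ 2) : finGroupType); split.
    - by rewrite card_ord.
    - by left; exists 2%N.
    - by apply: (group_iso_conj hK h'K SS'); apply: cyclic_iso ES.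
  exists Dihedral8; split.
  - by rewrite -cardsT [X in (X <= _)%N](card_dihedral (isT : 1 < 4)%N).
  - by right; right.
  - by apply: (group_iso_conj hK h'K SS'); apply: D8_iso ES.
have {}S2 t : S t -> t \o t = id.
  by move=> St'; apply: contrapT => ne; apply: S2; exists t.
have [h [h' [hM h'M hK h'K rE]]] := isMob_normal_form (SM _ St).
have [SS' S'M S'C S'4] := conj h h' hM h'M hK h'K.
have h'h z : h' (h z) = z by exact: (congr1 (@^~ z) h'K).
have hh' z : h (h' z) = z by exact: (congr1 (@^~ z) hK).
set S' := (fun t => S (h \o t \o h')) in SS' S'M S'C S'4.
have S'2 t : S' t -> t \o t = id.
  move=> /S2 e; apply: funext => z; have := congr1 (fun f => h' (f (h z))) e.
  by rewrite /= !h'h.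
case: rE => [[a a0 e]|e].
  have Sa : S' (scal a) by rewrite /S' -e.
  have : a ^+ 2 == 1.
    by apply/eqP/scal_inj; rewrite scal1 expr2 -scal_comp; apply: S'2.
  rewrite sqrf_eq1 => /orP[] /eqP ea.
    by case: ntau; rewrite e ea scal1; exact: hK.
  rewrite ea in Sa.
  have pi : 2.-primitive_root (-1 : K) by apply: (@prim_root_2exp _ 0).
  have [ES|[b b0 ES]] := @rotations_and_flips 2 (-1) S' isT pi S'M S'C Sa
    (fun t => @normalized_by_rotation2 S' t S'M S'C S'2 Sa).
    exists ('Z_(2 ^ 1) : finGroupType); split.
    - by rewrite card_ord.
    - by left; exists 1%N.
    - by apply: (group_iso_conj hK h'K SS'); apply: cyclic_iso ES.
  exists Klein4; split.
  - by rewrite card_prod !card_ord.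
  - by right; left.
  - by apply: (group_iso_conj hK h'K SS'); apply: klein_iso ES.
have := S'4 (mob 1 1 0 1); rewrite -e => /(_ St)/(congr1 (@^~ (Some 0))).
by rewrite iter_translation => -[] /eqP; rewrite pnatr_eq0.
Qed.

End Exponent4.

(** * Iterates of a quadratic map *)

Section QuadraticMaps.
Variable K : numClosedFieldType.
Implicit Types (x y a b : K) (z w : option K) (F g h : option K -> option K).

Definition deck F g := isMob g /\ F \o g = F.

Lemma deck_comp F g h : deck F g -> deck F h -> deck F (g \o h).
Proof.
by move=> [gM Fg] [hM Fh]; split; [exact: isMob_comp|rewrite compA Fg].
Qed.

Lemma sq_proj x y : nonzero2 x y -> sq (proj x y) = proj (x ^+ 2) (y ^+ 2).
Proof. by rewrite /proj expf_eq0 /=; case: eqP => //= _ _; rewrite expr_div_n. Qed.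

Lemma sq_scal a z : sq (scal a z) = scal (a ^+ 2) (sq z).
Proof. by case: z => [x|]; rewrite /= !(scalE, scal_inf) //= exprMn. Qed.

Lemma sq_surj z : exists w, sq w = z.
Proof. by case: z => [x|]; [exists (Some (sqrtC x)); rewrite /= sqrtCK|exists None]. Qed.

(* If [g] moved [0], then [g] and [z |-> - z] would generate a translation. *)
Lemma deck_fix_inf d F D g : isfib d F D -> deck F (scal (-1)) -> deck F g ->
  g None = None -> g (Some 0) = Some 0.
Proof.
move=> fD [_ Ft] [[a [b [c [e [De eg]]]]] Fg]; rewrite eg mob_inf mob_0.
have [c0 _|c0] := eqVneq c 0; last by rewrite /proj c0.
subst c; move: De; rewrite mulr0 subr0 mulf_eq0 negb_or => /andP[a0 e0].
have [->|b0] := eqVneq b 0; first by rewrite /proj e0 mul0r.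
have gE x : g (Some x) = Some ((a * x + b) / e).
  by rewrite eg /mob /proj /= mul0r add0r !mulr1 e0.
(* With sigma the map z |-> - z, the composite g sigma g^-1 sigma is the translation by [s];
   rescaling makes it the unit translation. *)
pose s := 2 * b / e.
have s0 : s != 0 by rewrite !mulf_neq0 ?invr_eq0 ?pnatr_eq0.
have Ftz z : F (scal (-1) z) = F z by exact: (congr1 (@^~ z) Ft).
have Fgz z : F (g z) = F z by exact: (congr1 (@^~ z) Fg).
have sK : scal s \o scal s^-1 = id by rewrite scal_comp divff // scal1.
case: (deck_translation (isfib_comp fD (isfib_mob (isMob_scal s0) sK))).
apply: funext => -[x|] /=; last first.
  by rewrite mob_inf /proj eqxx.
rewrite /mob /proj /= mul0r add0r !mul1r oner_eq0 divr1 !scalE.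
(* The preimage of - (s * x) under [g]. *)
pose u := (- (e * (s * x)) - b) / a.
have FN v : F (Some (- v)) = F (Some v) by rewrite -[RHS]Ftz scalE mulN1r.
have -> : Some (s * (x + 1)) = g (Some (- u)).
  by rewrite gE /u /s; congr Some; field; rewrite a0 e0.
rewrite Fgz FN -Fgz gE -[RHS]FN; congr (F (Some _)).
by rewrite /u; field; rewrite a0 e0.
Qed.

(** Conjugation by z |-> 1 / z exchanges 0 and infinity and commutes with z |-> - z. *)
Lemma deck_fix_0 d F D g : isfib d F D -> deck F (scal (-1)) -> deck F g ->
  g (Some 0) = Some 0 -> g None = None.
Proof.
move=> fD [tM Ft] [gM Fg] g0.
have o0 : (1 : K) != 0 by rewrite oner_eq0.
have f1M := isMob_flip o0.
have ff : flip (1 : K) \o flip 1 = id by rewrite flip_flip // divff // scal1.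
have fs : flip (1 : K) \o scal (-1) = scal (-1) \o flip 1.
  by rewrite flip_scal ?scal_flip ?oppr_eq0 // invrN invr1 mul1r mulr1.
have ffz z : flip 1 (flip 1 z) = z by exact: (congr1 (@^~ z) ff).
have := deck_fix_inf (g := flip 1 \o g \o flip 1) (isfib_comp fD (isfib_mob f1M ff)).
rewrite /= flip_inf g0 flip0 => H.
have {H} : flip 1 (g None) = Some 0.
  apply: H => //; split=> //.
  - by rewrite -compA fs compA Ft.
  - exact: (isMob_comp (isMob_comp f1M gM) f1M).
  - by apply: funext => z /=; rewrite ffz (congr1 (@^~ _) Fg : F (g _) = _).
by move=> /(congr1 (flip 1)); rewrite ffz flip0.
Qed.

Section Iterates.
Variables M M' : option K -> option K.
Hypotheses (MM : isMob M) (MK : M \o M' = id) (M'K : M' \o M = id).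
Let f := M \o sq (K:=K).

Definition crit z := (z == Some 0) || (z == None).

Let Mk z : M (M' z) = z. Proof. exact: (congr1 (@^~ z) MK). Qed.
Let M'k z : M' (M z) = z. Proof. exact: (congr1 (@^~ z) M'K). Qed.

Lemma mult_sq z : mult (@sq_fib K) (@sq K) z = (2 ^ crit z)%N.
Proof.
case: z => [x|] //; rewrite /mult /= /crit orbF !(inj_eq (@Some_inj _)).
have [->|x0] := eqVneq x 0; first by rewrite expr0n sqrtC0 oppr0 eqxx.
have /eqP : sqrtC (x ^+ 2) ^+ 2 = x ^+ 2 by rewrite sqrtCK.
have xx : (x == - x) = false.
  by rewrite -addr_eq0 -mulr2n mulrn_eq0 (negPf x0).
rewrite eqf_sqr => /orP[] /eqP ->; rewrite ?opprK eqxx ?[_ == x]eq_sym ?xx //.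
Qed.

Lemma iter_fib k : exists D, isfib (2 ^ k) (iter k f) D /\
  forall z, mult D (iter k f) z = (2 ^ visits f (Some 0%R) None k z)%N.
Proof.
have ff := isfib_comp (isfib_mob MM MK) (isfib_sq K).
elim: k => [|k [D [fD mD]]].
  exists (fun w => [:: w]); split; first exact: (isfib_mob (isMob_id K)).
  by move=> z; rewrite /mult /= eqxx /visits big_nil.
have := isfib_comp ff fD; rewrite mul1n -expnS => fD'.
eexists; split; first exact: fD'.
move=> z; have := mult_comp z ff fD => ->.
rewrite mD (mult_comp _ (isfib_mob MM MK) (isfib_sq K)) mult_mob // mul1n mult_sq.
by rewrite -[k.+1]addn1 visitsD visits1 -expnD addnC.
Qed.

Lemma deck_visits k g z : deck (iter k f) g ->
  visits f (Some 0) None k (g z) = visits f (Some 0) None k z.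
Proof.
move=> [gM kg]; have [D [fD mD]] := iter_fib k.
by apply: (expnI (isT : 1 < 2)%N); rewrite -!mD; apply: mult_deck fD gM kg.
Qed.

Lemma deck_iterE k g z : deck (iter k f) g -> iter k f (g z) = iter k f z.
Proof. by move=> [_ e]; exact: (congr1 (@^~ z) e). Qed.

Lemma deck_leq k l g : (k <= l)%N -> deck (iter k f) g -> deck (iter l f) g.
Proof.
move=> kl dg; split; first by case: dg.
by apply: funext => z /=; rewrite -(subnK kl) !iterD (deck_iterE _ dg).
Qed.

Lemma deck_neg k : (0 < k)%N -> deck (iter k f) (scal (-1)).
Proof.
move=> k0; apply: (deck_leq k0); split.
  by apply: isMob_scal; rewrite oppr_eq0 oner_eq0.
by apply: funext => z; rewrite /= /f /= sq_scal sqrrN expr1n scal1.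
Qed.

Lemma iter_surj k z : exists w, iter k f w = z.
Proof.
elim: k z => [|k IH] z; first by exists z.
have [w ew] := IH z; have [u eu] := sq_surj (M' w).
by exists u; rewrite iterSr /f /= eu Mk ew.
Qed.

Lemma deck_exponent4_nonperiodic k g : ~ periodic f (Some 0) -> ~ periodic f None ->
  deck (iter k f) g -> iter 4 g = id.
Proof.
move=> np1 np2 [gM kg]; have [D [fD mD]] := iter_fib k.
apply: (deck_order fD gM kg) => z; rewrite mD.
by rewrite -[4%N]/(2 ^ 2)%N dvdn_exp2l // visits_le2.
Qed.

Lemma deck_preserves_crit k g : periodic f (Some 0) \/ periodic f None ->
  deck (iter k f) g -> crit (g (Some 0)) /\ crit (g None).
Proof.
move=> per dg.
have [l [kl [c cc lc]]] : exists l, (k < l)%N /\ exists2 c, crit c &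
    forall h, deck (iter l f) h -> crit (h c).
  case: per => per.
    (* Using [k.+1] makes [l] positive, so that z |-> - z is a deck map of f^l. *)
    have [l [kl [c cc H]]] := critical_characterized None k.+1 per.
    exists l; split => //; exists c; first by rewrite /crit; case: cc => ->; rewrite eqxx ?orbT.
    by move=> h dh; apply: H; [exact: deck_iterE|exact: deck_visits].
  have [l [kl [c cc H]]] := critical_characterized (Some 0) k.+1 per.
  exists l; split => //; exists c; first by rewrite /crit; case: cc => ->; rewrite eqxx ?orbT.
  move=> h dh; rewrite /crit orbC; apply: H; first exact: deck_iterE.
  by rewrite visitsC deck_visits // visitsC.
have {}dg := deck_leq (ltnW kl) dg.
have dt : deck (iter l f) (scal (-1)) by apply: deck_neg; case: (l) kl.
have [D [fD _]] := iter_fib l.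
have gc := lc _ dg; have ggc := lc _ (deck_comp dg dg).
case/orP: cc => /eqP ec; rewrite ec in gc ggc.
  split=> //; case/orP: gc => /eqP g0; last by move: ggc; rewrite /= g0.
  by rewrite (deck_fix_0 fD dt dg g0) /crit eqxx orbT.
split=> //; case/orP: gc => /eqP g0; first by move: ggc; rewrite /= g0.
by rewrite (deck_fix_inf fD dt dg g0) /crit eqxx.
Qed.

Lemma crit_preserving g : isMob g -> crit (g (Some 0)) -> crit (g None) ->
  (exists2 a, a != 0 & g = scal a) \/ exists2 b, b != 0 & g = flip b.
Proof.
move=> gM /orP[] /eqP g0 /orP[] /eqP gi.
- by have := isMob_inj gM (etrans g0 (esym gi)).
- by left; exact: isMob_fix0inf.
- by right; exact: isMob_swap0inf.
- by have := isMob_inj gM (etrans g0 (esym gi)).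
Qed.

(** The surjective map f intertwines [scal a] with M o scal (a^2) o M', because squaring intertwines
    [scal a] with [scal (a ^+ 2)]. *)
Lemma deck_descends k a : deck (iter k.+1 f) (scal a) -> a != 0 ->
  deck (iter k f) (M \o scal (a ^+ 2) \o M').
Proof.
move=> da a0; split.
  have [M'' [M''M e1 e2]] := isMob_inv MM.
  have -> : M' = M''.
    by apply: funext => z; rewrite -[in RHS](Mk z) (congr1 (@^~ _) e2 : M'' (M _) = _).
  by apply: isMob_comp => //; apply: isMob_comp => //; apply: isMob_scal; rewrite expf_neq0.
apply: funext => z /=; have [u eu] := sq_surj (M' z).
by rewrite -eu -sq_scal -[M (sq _)]/(f _) -iterSr (deck_iterE _ da) iterSr /f /= eu Mk.
Qed.

(* A rotation [z |-> a z] descends along [f] to an element of [Deck (f^(k-1))] fixing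
   the critical values; since it also preserves the critical points, it has order at
   most 2. *)
Lemma deck_exponent4 k g : ~~ (crit (M (Some 0)) && crit (M None)) ->
  deck (iter k f) g -> iter 4 g = id.
Proof.
move=> nM dg.
have [per|nper] := pselect (periodic f (Some 0) \/ periodic f None); last first.
  apply: deck_exponent4_nonperiodic dg; first by move=> p; apply: nper; left.
  by move=> p; apply: nper; right.
have [c0 ci] := deck_preserves_crit per dg.
case: (crit_preserving (proj1 dg) c0 ci) => [[a a0 eg]|[b b0 ->]]; last first.
  have e : flip b \o flip b = id by rewrite flip_flip // divff // scal1.
  by apply: funext => z /=; rewrite !(congr1 (@^~ _) e : flip b (flip b _) = _).
case: k dg => [|k dg].
  by move=> [_ /= e]; apply: funext => z; rewrite !iterS !(congr1 (@^~ _) e : g _ = _).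
rewrite eg in dg; pose h := M \o scal (a ^+ 2) \o M'.
have dh : deck (iter k f) h by exact: deck_descends.
have [h0 hi] := deck_preserves_crit per dh.
have hh : h \o h = id.
  case: (crit_preserving (proj1 dh) h0 hi) => [[r r0 eh]|[b b0 ->]]; last first.
    by rewrite flip_flip // divff // scal1.
  suff r1 : r = 1 by rewrite eh r1 scal1.
  have fixr z : ~~ crit z -> scal r z = z -> r = 1.
    case: z => [x|]; last by rewrite /crit eqxx orbT.
    rewrite /crit orbF (inj_eq (@Some_inj _)) scalE => x0 [] /eqP.
    by rewrite -subr_eq0 -{2}[x]mul1r -mulrBl mulf_eq0 (negPf x0) orbF subr_eq0 => /eqP.
  case/nandP: nM => nz; apply: (fixr _ nz); rewrite -eh /h /= M'k.
    by rewrite scalE mulr0.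
  by rewrite scal_inf.
rewrite eg iter_scal -scal1; congr scal.
apply: scal_inj; rewrite -[4%N]/(2 + 2)%N exprD -scal_comp scal1.
apply: funext => z; have := congr1 (fun t => M' (t (M z))) hh.
by rewrite /h /= !M'k.
Qed.

(** Here f maps {0, oo} into itself, and each critical point is the only preimage of its image. *)
Lemma iter_inj_crit k z c : crit (M (Some 0)) -> crit (M None) -> crit c ->
  iter k f z = iter k f c -> z = c.
Proof.
move=> c0 ci; elim: k z c => [|k IH] z c cc //.
rewrite !iterSr => /IH; rewrite /f /=.
have cf : crit (M (sq c)) by case/orP: cc => /eqP -> //=; rewrite expr0n.
move=> /(_ cf)/(isMob_inj MM).
case/orP: cc => /eqP ->; case: z => //= x [] /eqP.
by rewrite expr0n sqrf_eq0 => /eqP ->.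
Qed.

(** In this case f is z |-> m z^2 or z |-> m z^-2: each step squares the factor and possibly inverts
    it. *)
Lemma iter_scal_equivariant k a : crit (M (Some 0)) -> crit (M None) -> a != 0 ->
  exists2 b, b = a ^+ (2 ^ k) \/ b = (a ^+ (2 ^ k))^-1 &
    iter k f \o scal a = scal b \o iter k f.
Proof.
move=> c0 ci a0.
have Ms b : b != 0 -> exists2 b', b' = b \/ b' = b^-1 & M \o scal b = scal b' \o M.
  move=> b0; case: (crit_preserving MM c0 ci) => [[m m0 ->]|[m m0 ->]].
    by exists b; [left|rewrite !scal_comp mulrC].
  by exists b^-1; [right|rewrite flip_scal // scal_flip ?invr_eq0 // mulrC].
elim: k => [|k [b bE e]]; first by exists a; [left|].
have b0 : b != 0 by case: bE => ->; rewrite ?invr_eq0 expf_neq0.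
have [b' b'E e'] := Ms _ (expf_neq0 2 b0); exists b'.
  case: b'E => ->; case: bE => ->; rewrite expnSr exprM ?exprVn ?invrK; auto.
apply: funext => z; rewrite /= (congr1 (@^~ z) e : iter k f (scal a z) = _) /f /= sq_scal.
exact: (congr1 (@^~ _) e').
Qed.

Lemma deck_power k t : crit (M (Some 0)) -> crit (M None) ->
  deck (iter k f) t <-> exists2 a, a ^+ (2 ^ k) = 1 & t = scal a.
Proof.
move=> c0 ci; split=> [dt|[a a1 ->]].
  have t0 : t (Some 0) = Some 0.
    by apply: (iter_inj_crit c0 ci _ (deck_iterE _ dt)); rewrite /crit eqxx.
  have ti : t None = None.
    by apply: (iter_inj_crit c0 ci _ (deck_iterE _ dt)); rewrite /crit eqxx orbT.
  have [a a0 et] := isMob_fix0inf (proj1 dt) t0 ti.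
  exists a => //; have [b bE] := iter_scal_equivariant k c0 ci a0.
  rewrite -et (proj2 dt) => e.
  have b1 : b = 1.
    apply: scal_inj; rewrite scal1; apply: funext => z.
    by have [w <-] := iter_surj k z; exact: (esym (congr1 (@^~ w) e)).
  by case: bE; rewrite b1 => // /esym /(congr1 GRing.inv); rewrite invrK invr1.
have a0 : a != 0.
  by apply/eqP => a0; move/eqP: a1; rewrite a0 expr0n expn_eq0 eq_sym oner_eq0.
split; first exact: isMob_scal.
have [b bE ->] := iter_scal_equivariant k c0 ci a0.
by case: bE; rewrite a1 ?invr1 => ->; rewrite scal1.
Qed.

Lemma exists_root_neg1 n : exists z : K, z ^+ (2 ^ n) = -1.
Proof.
elim: n => [|n [z ez]]; first by exists (-1); rewrite expr1.
by exists (sqrtC z); rewrite expnS exprM sqrtCK.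
Qed.

Lemma deck_power_iso k : (0 < k)%N -> crit (M (Some 0)) -> crit (M None) ->
  group_iso_to ('Z_(2 ^ k) : finGroupType) (deck (iter k f)).
Proof.
case: k => // k _ c0 ci; have [z ez] := exists_root_neg1 k.
have pz := prim_root_2exp ez.
apply: (cyclic_iso _ pz); first by rewrite -{1}(expn0 2) ltn_exp2l.
move=> t; rewrite deck_power //; split=> [[a a1 ->]|[i ->]].
  by have [i ->] := prim_rootP pz a1; exists i.
by exists (z ^+ i) => //; rewrite exprAC (prim_expr_order pz) expr1n.
Qed.

Lemma deck_nonpower_iso k : (0 < k)%N -> ~~ (crit (M (Some 0)) && crit (M None)) ->
  exists gT : finGroupType, [/\ (#|gT| <= 8)%N,
    (exists2 n, (0 < n)%N & gT = 'Z_(2 ^ n) :> finGroupType) \/ gT = Klein4 \/ gT = Dihedral8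
    & group_iso_to gT (deck (iter k f))].
Proof.
move=> k0 nM; apply: exponent4_classification.
- by move=> t [].
- exact: deck_comp.
- by move=> t; exact: deck_exponent4.
exists (scal (-1)); first exact: deck_neg.
by rewrite -scal1 => /scal_inj /eqP; rewrite (negPf (neg1_neq1 K)).
Qed.

End Iterates.

(** * Quadratic maps as the squaring map between two Moebius maps *)

Lemma quad_square (r0 r1 r2 : K) : r1 ^+ 2 = 4 * r0 * r2 -> exists a b,
  forall x y, r0 * y ^+ 2 + r1 * (x * y) + r2 * x ^+ 2 = (a * x + b * y) ^+ 2.
Proof.
move=> dr; have [r20|r20] := eqVneq r2 0.
  have r10 : r1 = 0 by apply/eqP; rewrite -sqrf_eq0 dr r20 mulr0.
  exists 0, (sqrtC r0) => x y; rewrite r20 r10.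
  by have := sqrtCK r0; move: (sqrtC r0) => s <-; ring.
have a0 : sqrtC r2 != 0 by rewrite sqrtC_eq0.
exists (sqrtC r2), (r1 / (2 * sqrtC r2)) => x y.
have e2 := sqrtCK r2; move: (sqrtC r2) a0 e2 => a a0 e2.
have e0 : r0 = r1 ^+ 2 / (4 * a ^+ 2).
  by rewrite dr e2; field; rewrite r20.
by rewrite e0 -e2; field; rewrite a0.
Qed.

Lemma quad_root (q0 q1 q2 : K) : exists x y, nonzero2 x y /\
  q0 * y ^+ 2 + q1 * (x * y) + q2 * x ^+ 2 = 0.
Proof.
have [q20|q20] := eqVneq q2 0.
  exists 1, 0; split; first by rewrite /nonzero2 oner_eq0.
  by rewrite q20; ring.
pose s := sqrtC (q1 ^+ 2 - 4 * q0 * q2).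
have s2 : s ^+ 2 = q1 ^+ 2 - 4 * q0 * q2 by rewrite sqrtCK.
exists ((- q1 + s) / (2 * q2)), 1; split; first by rewrite /nonzero2 oner_eq0 orbT.
have -> : q0 = (q1 ^+ 2 - s ^+ 2) / (4 * q2) by rewrite s2; field; rewrite q20.
by field; rewrite q20.
Qed.

Definition quad (q0 q1 q2 x y : K) := q0 * y ^+ 2 + q1 * (x * y) + q2 * x ^+ 2.

Definition lifts F (P Q : K -> K -> K) := forall x y, nonzero2 x y ->
  nonzero2 (P x y) (Q x y) /\ F (proj x y) = proj (P x y) (Q x y).

Definition conj_sq F := exists M h, [/\ isMob M, isMob h & F = M \o sq (K:=K) \o h].

(** Completing the square in y writes the second form as q0 (y + q1 x / (2 q0))^2 plus a multiple of
    x^2; here q0 != 0, as otherwise both coordinates vanish at (0, 1). *)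
Lemma conj_sq_x2 F q0 q1 q2 : lifts F (fun x _ => x ^+ 2) (quad q0 q1 q2) -> conj_sq F.
Proof.
move=> L; have q00 : q0 != 0.
  have [] := L 0 1; first by rewrite /nonzero2 oner_eq0 orbT.
  by move=> + _; rewrite /nonzero2 /quad !expr2 !(mul0r, mulr0, mulr1, addr0) eqxx.
have D1 : 1 * q0 - 0 * (q2 - q1 ^+ 2 / (4 * q0)) != 0 by rewrite mul1r mul0r subr0.
have D2 : (1 : K) * 1 - 0 * (q1 / (2 * q0)) != 0 by rewrite mul1r mul0r subr0 oner_eq0.
exists (mob 1 0 (q2 - q1 ^+ 2 / (4 * q0)) q0), (mob 1 0 (q1 / (2 * q0)) 1).
split; [exact: isMob_mob|exact: isMob_mob|].
apply: funext => z; rewrite -[z]projK /=; have nz := nonzero2_h z.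
move: (hx z) (hy z) nz => x y nz; have [_ ->] := L x y nz.
have nz' := nonzero2_lin D2 nz.
rewrite mob_proj // sq_proj // mob_proj //; last first.
  by move: nz'; rewrite /nonzero2 !expf_eq0.
rewrite /quad; congr proj; first by ring.
by field; rewrite q00.
Qed.

Lemma conj_sq_precomp F h h' : isMob h -> isMob h' -> h \o h' = id ->
  conj_sq (F \o h) -> conj_sq F.
Proof.
move=> hM h'M hK [M [g [MM gM e]]]; exists M, (g \o h'); split=> //.
  exact: isMob_comp.
by apply: funext => z; have /= <- := congr1 (@^~ (h' z)) e; rewrite (congr1 (@^~ z) hK : h (h' z) = z).
Qed.

Lemma conj_sq_postcomp F h h' : isMob h -> isMob h' -> h' \o h = id ->
  conj_sq (h \o F) -> conj_sq F.
Proof.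
move=> hM h'M hK [M [g [MM gM e]]]; exists (h' \o M), g; split=> //.
  exact: isMob_comp.
by apply: funext => z; have /= <- := congr1 (@^~ z) e; rewrite (congr1 (@^~ _) hK : h' (h _) = _).
Qed.

Lemma lifts_eq F P Q P' Q' : lifts F P Q -> (forall x y, P x y = P' x y) ->
  (forall x y, Q x y = Q' x y) -> lifts F P' Q'.
Proof. by move=> L eP eQ x y nz; rewrite -eP -eQ; apply: L. Qed.

Lemma lifts_precomp F P Q a b c d : a * d - b * c != 0 -> lifts F P Q ->
  lifts (F \o mob a b c d) (fun x y => P (a * x + b * y) (c * x + d * y))
    (fun x y => Q (a * x + b * y) (c * x + d * y)).
Proof.
by move=> D L x y nz; rewrite /= mob_proj //; apply: L; apply: nonzero2_lin.
Qed.

Lemma lifts_postcomp F P Q a b c d : a * d - b * c != 0 -> lifts F P Q ->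
  lifts (mob a b c d \o F) (fun x y => a * P x y + b * Q x y)
    (fun x y => c * P x y + d * Q x y).
Proof.
move=> D L x y nz; have [nz' e] := L x y nz.
by rewrite /= e mob_proj //; split=> //; apply: nonzero2_lin.
Qed.

(** A linear substitution turns a x + b y into x. This form is nonzero, since otherwise both
    coordinates of the lift would vanish at a zero of the second form. *)
Lemma conj_sq_square F a b q0 q1 q2 :
  lifts F (fun x y => (a * x + b * y) ^+ 2) (quad q0 q1 q2) -> conj_sq F.
Proof.
move=> L; have [a0|a0] := eqVneq a 0.
  have b0 : b != 0.
    apply/eqP => b0; have [x [y [nz e]]] := quad_root q0 q1 q2.
    have [] := L x y nz; rewrite /quad e a0 b0 !mul0r addr0 expr0n.
    by rewrite /nonzero2 eqxx.
  have D : (0 : K) * 0 - 1 * b^-1 != 0 by rewrite mul0r sub0r mul1r oppr_eq0 invr_eq0.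
  have hM := isMob_mob D; have [h' [h'M hK _]] := isMob_inv hM.
  apply: (conj_sq_precomp hM h'M hK).
  apply: (@conj_sq_x2 _ q2 (q1 / b) (q0 / b ^+ 2)); apply: lifts_eq (lifts_precomp D L) _ _.
    by move=> x y; rewrite a0; field.
  by move=> x y; rewrite /quad; field.
have D : a^-1 * 1 - (- b / a) * 0 != 0 by rewrite mulr1 mulr0 subr0 invr_eq0.
have hM := isMob_mob D; have [h' [h'M hK _]] := isMob_inv hM.
apply: (conj_sq_precomp hM h'M hK).
apply: (@conj_sq_x2 _ (q0 - q1 * b / a + q2 * b ^+ 2 / a ^+ 2) (q1 / a - 2 * q2 * b / a ^+ 2)
  (q2 / a ^+ 2)); apply: lifts_eq (lifts_precomp D L) _ _.
  by move=> x y; field.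
by move=> x y; rewrite /quad; field.
Qed.

(* The pencil spanned by the two quadratic forms contains a square. *)
Lemma conj_sq_quad F p0 p1 p2 q0 q1 q2 :
  lifts F (quad p0 p1 p2) (quad q0 q1 q2) -> conj_sq F.
Proof.
move=> L; pose A := p1 ^+ 2 - 4 * p0 * p2.
have [A0|A0] := eqVneq A 0.
  have /quad_square[a [b e]] : p1 ^+ 2 = 4 * p0 * p2 by apply/eqP; rewrite -subr_eq0 -A0.
  by apply: (@conj_sq_square _ a b q0 q1 q2); apply: lifts_eq L e _.
(* The discriminant of the member l p + q of the pencil is A l^2 + B l + E, and l is chosen as a
   root. *)
pose B := 2 * p1 * q1 - 4 * (p0 * q2 + p2 * q0); pose E := q1 ^+ 2 - 4 * q0 * q2.
pose s := sqrtC (B ^+ 2 - 4 * A * E); pose l := (- B + s) / (2 * A).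
have el : A * l ^+ 2 + B * l + E = 0.
  have -> : E = (B ^+ 2 - s ^+ 2) / (4 * A) by rewrite sqrtCK; field; rewrite A0.
  by rewrite /l; move: (s) (B) => s' B'; field; rewrite A0.
have D : l * 0 - 1 * 1 != 0 :> K by rewrite mulr0 sub0r mulr1 oppr_eq0 oner_eq0.
have hM := isMob_mob D; have [h' [h'M _ hK]] := isMob_inv hM.
apply: (conj_sq_postcomp hM h'M hK).
have /quad_square[a [b e]] : (l * p1 + q1) ^+ 2 = 4 * (l * p0 + q0) * (l * p2 + q2).
  apply/eqP; rewrite -subr_eq0 -el; apply/eqP; rewrite /A /B /E; ring.
apply: (@conj_sq_square _ a b p0 p1 p2); apply: lifts_eq (lifts_postcomp D L) _ _.
  by move=> x y; rewrite -e /quad; ring.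
by move=> x y; rewrite mul1r mul0r addr0.
Qed.

End QuadraticMaps.

(** * The Riemann sphere *)

Section RealSphere.
Variable R : realType.
Local Notation C := (R[i] : numClosedFieldType).
Implicit Types (f F t : sphere R -> sphere R) (p q : {poly R[i]}).

Lemma proj_lead p q : (maxn (size p) (size q)).-1 = 2%N ->
  rat_eval p q None = @proj C p`_2 q`_2.
Proof.
move=> sz; rewrite /rat_eval /proj.
have m3 : maxn (size p) (size q) = 3%N by case: (maxn _ _) sz => // n /= ->.
case: ltngtP => [qp|pq|e].
- have e : size q = size q by []. 
  rewrite (_ : q`_2 = 0) ?eqxx // nth_default //.
  by move: m3; rewrite (maxn_idPl (ltnW qp)) => e3; rewrite -ltnS -e3.
- have sq : size q = 3%N by move: m3; rewrite (maxn_idPr (ltnW pq)).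
  rewrite (_ : p`_2 = 0) ?mul0r; last by rewrite nth_default // -ltnS -sq.
  by have := lead_coef_eq0 q; rewrite -size_poly_eq0 sq lead_coefE sq => /= ->.
have [sp sq] : size p = 3%N /\ size q = 3%N by move: m3; rewrite -e maxnn.
have := lead_coef_eq0 q; rewrite -size_poly_eq0 !lead_coefE sp sq => /= ->.
by [].
Qed.

Lemma horner_quad p x : (size p <= 3)%N -> p.[x] = quad (K:=C) p`_0 p`_1 p`_2 x 1.
Proof.
move=> sp; rewrite (horner_coef_wide x sp) !big_ord_recl big_ord0 /quad /=.
by rewrite expr1n; ring.
Qed.

Lemma quad_homogeneous (q0 q1 q2 k x y : C) :
  quad q0 q1 q2 (k * x) (k * y) = k ^+ 2 * quad q0 q1 q2 x y.
Proof. by rewrite /quad; ring. Qed.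

(** Coprimality excludes a common zero at finite points, and degree exactly 2 excludes one at
    infinity. *)
Lemma rat_eval_lifts p q : coprimep p q -> (maxn (size p) (size q)).-1 = 2%N ->
  lifts (K:=C) (rat_eval p q) (quad p`_0 p`_1 p`_2) (quad q`_0 q`_1 q`_2).
Proof.
move=> cop sz.
have m3 : maxn (size p) (size q) = 3%N by case: (maxn _ _) sz => // n /= ->.
have sp : (size p <= 3)%N by rewrite -m3 leq_maxl.
have sq : (size q <= 3)%N by rewrite -m3 leq_maxr.
have L (z : option C) : nonzero2 (quad p`_0 p`_1 p`_2 (hx z) (hy z)) (quad q`_0 q`_1 q`_2 (hx z) (hy z)) /\
    rat_eval p q z = proj (quad p`_0 p`_1 p`_2 (hx z) (hy z)) (quad q`_0 q`_1 q`_2 (hx z) (hy z)).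
  case: z => [x|]; last rewrite proj_lead //= /quad.
    rewrite /= -!horner_quad //; split => //.
    rewrite /nonzero2; case: (boolP (root p x)) => [r|r]; last by rewrite -/(root p x) r.
    by rewrite (coprimep_root cop r) orbT.
  rewrite expr0n !mulr0 !add0r expr1n !mulr1; split => //.
  rewrite /nonzero2 -negb_and; apply/negP => /andP[/eqP p2 /eqP q2].
  have nsz (r : {poly R[i]}) : r`_2 = 0 -> size r != 3%N.
    move=> r2; apply/eqP => sr; have := lead_coef_eq0 r.
    by rewrite lead_coefE sr r2 eqxx => /esym; rewrite -size_poly_eq0 sr.
  move: m3; rewrite /maxn; case: ifP => _ m3; first by move: (nsz q q2); rewrite m3.
  by move: (nsz p p2); rewrite m3.
move=> x y nz; have [k k0 [ex ey]] := proj_hE nz; have [nz' e] := L (proj x y).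
rewrite [X in quad p`_0 p`_1 p`_2 X _]ex [X in quad p`_0 p`_1 p`_2 _ X]ey.
rewrite [X in quad q`_0 q`_1 q`_2 X _]ex [X in quad q`_0 q`_1 q`_2 _ X]ey.
rewrite !quad_homogeneous e proj_scale ?expf_neq0 //; split=> //.
by move: nz'; rewrite /nonzero2 !mulf_eq0 ?expf_eq0 (negPf k0).
Qed.

Lemma rat_eval_mob (a b c d : C) : a * d - b * c != 0 ->
  rat_eval (a *: 'X + b%:P) (c *: 'X + d%:P) = mob (K:=C) a b c d.
Proof.
move=> D; apply: funext => -[x|].
  by rewrite /rat_eval !hornerE /mob /proj /= !mulr1.
rewrite mob_inf /rat_eval /proj.
have sz (u v : C) : u != 0 -> size (u *: 'X + v%:P) = 2%N.
  move=> u0; rewrite size_polyDl size_scale ?size_polyX //.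
  by rewrite size_polyC; case: (v != 0).
have lc (u v : C) : u != 0 -> lead_coef (u *: 'X + v%:P) = u.
  by move=> u0; rewrite lead_coefE sz // coefD coefZ coefX coefC mulr1 addr0.
have sz0 (u v : C) : u = 0 -> (size (u *: 'X + v%:P)%R <= 1)%N.
  by move=> ->; rewrite scale0r add0r size_polyC; case: (v != 0).
have [c0|c0] := eqVneq c 0.
  have a0 : a != 0 by apply: contra_neq D => ->; rewrite c0 mul0r mulr0 subrr.
  by rewrite (sz _ _ a0) ltnS sz0.
have [a0|a0] := eqVneq a 0; last first.
  by rewrite (sz _ _ a0) (sz _ _ c0) ltnn (lc _ _ a0) (lc _ _ c0).
rewrite (sz _ _ c0) ltnNge (leq_trans (sz0 _ _ a0)) //= ltnS sz0 //.
by rewrite a0 mul0r.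
Qed.

Lemma moebiusE t : moebius t <-> isMob (K:=C) t.
Proof.
split=> -[a [b [c [d [D ->]]]]]; exists a, b, c, d; rewrite rat_eval_mob //.
Qed.

Lemma DeckE F t : Deck F t <-> deck (K:=C) F t.
Proof. by rewrite /Deck /deck moebiusE. Qed.

Lemma rat_eval_X2 : rat_eval 'X^2 1 = sq (K:=C).
Proof.
apply: funext => -[x|] /=; first by rewrite hornerXn hornerC oner_eq0 divr1.
by rewrite size_polyXn size_poly1.
Qed.

Lemma rat_eval_X2inv : rat_eval 1 'X^2 = flip (K:=C) 1 \o sq (K:=C).
Proof.
apply: funext => -[x|] /=; last by rewrite size_polyXn size_poly1 flip_inf.
by rewrite hornerXn hornerC /flip /mob /proj /= !(mul0r, mul1r, add0r, addr0).
Qed.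

Lemma power_map_crit (M h h' : sphere R -> sphere R) :
  isMob (K:=C) M -> isMob (K:=C) h -> isMob (K:=C) h' -> h \o h' = id -> h' \o h = id ->
  crit (K:=C) (h (M (Some 0))) -> crit (K:=C) (h (M None)) ->
  power_map (M \o sq (K:=C) \o h).
Proof.
move=> MM hM h'M hK h'K c0 ci.
have hM' : isMob (h \o M) by exact: isMob_comp.
have h'h z : h' (h z) = z by exact: (congr1 (@^~ z) h'K).
have hh' z : h (h' z) = z by exact: (congr1 (@^~ z) hK).
have Mz z : M z = h' ((h \o M) z) by rewrite /= h'h.
have scalK (s : C) z : s != 0 -> scal s^-1 (scal s z) = z.
  move=> s0; have e := scal_comp s^-1 s; rewrite mulVf // scal1 in e.
  exact: (congr1 (@^~ z) e).
have conj (s : C) : s != 0 -> [/\ moebius (h' \o scal s^-1), moebius (scal s \o h) &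
    (h' \o scal s^-1) \o (scal s \o h) = id /\ (scal s \o h) \o (h' \o scal s^-1) = id].
  move=> s0; have s0' : s^-1 != 0 by rewrite invr_eq0.
  split; [apply/moebiusE; apply: isMob_comp h'M _; exact: isMob_scal| |].
    by apply/moebiusE; apply: isMob_comp _ hM; exact: isMob_scal.
  split; apply: funext => z /=; first by rewrite scalK // h'h.
  by rewrite hh' -{1}[s]invrK scalK.
case: (crit_preserving hM' c0 ci) => [[m m0 e]|[m m0 e]].
  have [A1 A2 A3] := conj m m0; exists 2%N, (h' \o scal m^-1), (scal m \o h); split=> //; left.
  apply: funext => z; rewrite rat_eval_X2 /= Mz e sq_scal; congr (h' _).
  rewrite -[LHS]/((scal m) _) -[RHS]/((scal m^-1 \o scal (m ^+ 2)) _) scal_comp.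
  by rewrite expr2 mulKf.
(* The coordinate w = s z turns z |-> m / z^2 into w |-> s^3 m / w^2, hence s^3 = 1 / m. *)
pose s := (3.-root m)^-1 : C.
have s0 : s != 0 by rewrite invr_eq0 rootC_eq0.
have s3 : m = (s ^+ 3)^-1 by rewrite exprVn invrK rootCK.
have [A1 A2 A3] := conj s s0; exists 2%N, (h' \o scal s^-1), (scal s \o h); split=> //; right.
apply: funext => z; rewrite rat_eval_X2inv /= Mz e sq_scal; congr (h' _).
rewrite -[RHS]/((scal s^-1 \o (flip 1 \o scal (s ^+ 2))) _).
have s1' : s^-1 != 0 by rewrite invr_eq0.
have s2' : 1 / s ^+ 2 != 0 by rewrite mul1r invr_eq0 expf_neq0.
rewrite (flip_scal (expf_neq0 2 s0) (oner_neq0 _)) (scal_flip s1' s2').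
by congr flip; rewrite s3 mul1r -invfM -exprS.
Qed.

Lemma card_bound (gT : finGroupType) (S : (sphere R -> sphere R) -> Prop) (m : nat)
    (t : 'I_m -> sphere R -> sphere R) :
  group_iso_to gT S -> injective t -> (forall i, S (t i)) -> (m <= #|gT|)%N.
Proof.
move=> [phi [_ _ im]] tI tS.
have H i : {g | phi g = t i} by apply: cid; apply/im.
rewrite -[m]card_ord; apply: (@leq_card _ _ (fun i => sval (H i))) => i j e.
by apply: tI; rewrite -(svalP (H i)) -(svalP (H j)) e.
Qed.

End RealSphere.

Theorem theorem4 (R : realType) (f : sphere R -> sphere R) (k : nat) :
  rational_map_of_degree 2 f -> (0 < k)%N ->
  ((exists n : nat, (0 < n)%N /\ group_iso_to ('Z_(2 ^ n) : finGroupType) (Deck (iter k f)))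
   \/ group_iso_to Klein4 (Deck (iter k f))
   \/ group_iso_to Dihedral8 (Deck (iter k f)))
  /\ (~ power_map f ->
      forall (m : nat) (t : 'I_m -> (sphere R -> sphere R)),
        injective t -> (forall i, Deck (iter k f) (t i)) -> (m <= 8)%N).
Proof.
move=> [p [q [cop sz _ fE]]] k0.
have [M [h [MM hM]]] := conj_sq_quad (rat_eval_lifts cop sz); rewrite -fE => {}fE.
have [h' [h'M hK h'K]] := isMob_inv hM.
have h'h z : h' (h z) = z by exact: (congr1 (@^~ z) h'K).
have hh' z : h (h' z) = z by exact: (congr1 (@^~ z) hK).
have [N [_ NK KN]] := isMob_inv (isMob_comp hM MM).
(* Conjugating f = M o sq o h by [h] moves its critical points to 0 and infinity and conjugates the
   deck groups. *)
pose f' := (h \o M) \o sq (K := R[i]).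
have fE' z : iter k f z = h' (iter k f' (h z)).
  elim: k {k0} => [|k IH] /=; first by rewrite h'h.
  by rewrite IH fE /f' /= hh' h'h.
have DE t : Deck (iter k f) t <-> deck (iter k f') (h \o t \o h').
  rewrite DeckE; split=> -[tM te]; split.
  - by apply: isMob_comp h'M; apply: isMob_comp.
  - apply: funext => z; have := congr1 (fun F => h (F (h' z))) te.
    by rewrite /= !fE' !hh'.
  - have -> : t = h' \o (h \o t \o h') \o h by apply: funext => z /=; rewrite !h'h.
    by apply: isMob_comp hM; apply: isMob_comp.
  - apply: funext => z; have := congr1 (fun F => h' (F (h z))) te.
    by rewrite /= !fE' !h'h.
have iso (gT : finGroupType) : group_iso_to gT (deck (iter k f')) ->
    group_iso_to gT (Deck (iter k f)) by exact: (group_iso_conj h'K hK DE).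
have [/andP[c0 ci]|nc] := boolP (crit (h (M (Some 0))) && crit (h (M None))).
  split; last by case; rewrite fE; exact: power_map_crit hK h'K c0 ci.
  left; exists k; split=> //; apply: iso.
  exact: (deck_power_iso (isMob_comp hM MM) NK k0 c0 ci).
have [gT [card8 gTE /iso gTiso]] := deck_nonpower_iso (isMob_comp hM MM) NK KN k0 nc.
split; last first.
  by move=> _ m t tI tD; apply: leq_trans (card_bound gTiso tI tD) card8.
case: gTE => [[n n0 e]|[e|e]]; rewrite e in gTiso; last 2 first.
- by right; left.
- by right; right.
by left; exists n.
Qed.
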